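(* Let $1\le k\le n$ and let $\mathcal J$ be a Grassmann necklace of type $(k,n)$ whose positroid is connected, with positroid polytope $P_\mathcal J\subset\mathbb R^n$. Let $p:\mathbb R^n\to\mathbb R^{n-1}$ be the projection onto the first $n-1$ coordinates, and let $\tilde P_\mathcal J$ be $p(P_\mathcal J)$ with all its upper facets removed. Then $$h^*(\tilde P_\mathcal J,z)=\sum_{w\in D_\mathcal J} z^{\mathrm{des}(w_1\cdots w_{n-1})+1},$$ where $\mathrm{des}(w_1\cdots w_{n-1})=\#\{i\in[n-2]: w_i>w_{i+1}\}$.
   Context: Grassmann necklace of type $(k,n)$: a sequence $(J_1,\dots,J_n)$ of $k$-subsets of $[n]$ with, for each $i$ mod $n$, $J_{i+1}=(J_i\setminus\{i\})\cup\{j\}$ for some $j$ if $i\in J_i$, and $J_{i+1}=J_i$ otherwise. With the $i$-order $i<_i i+1<_i\cdots<_i n<_i1<_i\cdots<_i i-1$ and Gale order $S\le_i T$ iff the $j$-th smallest elements (in $<_i$) satisfy $s_j\le_i t_j$ for all $j$, the positroid has bases $\{B: B\ge_i J_i\ \forall i\}$ and $P_\mathcal J=\mathrm{conv}\{\sum_{b\in B}e_b\}$ over bases; connected means the matroid is not a direct sum of two matroids on nonempty ground sets (then $p(P_\mathcal J)$ is full-dimensional in $\mathbb R^{n-1}$). Upper facet: a facet of $p(P_\mathcal J)$ of the form $\{x: x_i+x_{i+1}+\cdots+x_{j-1}=c\}$ with $1\le i<j\le n$ and $c\in\mathbb Z$ such that $p(P_\mathcal J)\subseteq\{x: x_i+\cdots+x_{j-1}\le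 c\}$. For $w\in S_n$: $i<n$ is a cyclic left descent if $i$ occurs to the right of $i+1$ in $w$; $n$ is one if $1$ occurs to the left of $n$; $\mathrm{cDes}_L(w)$ is the set of these. $w^{(r)}$ is the cyclic rotation of $w_1\cdots w_n$ ending in $r$, $I_r(w)=\mathrm{cDes}_L(w^{(r)})$. $D_\mathcal J$ is the set of $w\in S_n$ with $w_n=n$, exactly $k$ cyclic left descents, and $I_r(w)\ge_j J_j$ for all $r,j\in[n]$. For a (possibly half-open) lattice polytope $Q\subset\mathbb R^{n-1}$ of dimension $n-1$, $E(Q,t)=\#(tQ\cap\mathbb Z^{n-1})$ for $t\ge1$ is a polynomial in $t$; using its polynomial value at $t=0$, $h^*(Q,z)$ is defined by $\sum_{t\ge0}E(Q,t)z^t=h^*(Q,z)/(1-z)^{n}$.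
   Formalization: The theorem assumes n ≥ 2: for n = k = 1 the positroid is connected and the polytope is a point with h* = 1, but 1 is not to the left of itself, so D_J is empty and the right-hand side is 0. *)

(* Defs.v *)
From mathcomp Require Import all_boot all_order all_algebra all_fingroup.

Set Implicit Arguments.
Unset Strict Implicit.
Unset Printing Implicit Defensive.

Import Order.TTheory GRing.Theory Num.Theory.

Local Open Scope nat_scope.

(* The ground set [n] = {1, .., n} is rendered as 'I_n = {0, .., n-1}, so the
   element i of [n] is the ordinal i - 1, and [ordS] is i |-> i + 1 modulo n. *)

Section Positroids.
Variable n : nat.
Implicit Types (i j x y : 'I_n) (S T A B : {set 'I_n}).
Implicit Types (M : {set {set 'I_n}}) (J : 'I_n -> {set 'I_n}).

Definition grassmann_necklace (k : nat) J : Prop :=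
  (forall i, #|J i| = k) /\
  (forall i, if i \in J i then exists j, J (ordS i) = j |: (J i :\ i)
             else J (ordS i) = J i).

(* position of x in the i-order i < i+1 < ... < n < 1 < ... < i-1 *)
Definition cyc_pos i x : nat := (x + (n - i)) %% n.
Definition cyc_le i : rel 'I_n := fun x y => cyc_pos i x <= cyc_pos i y.

Definition gale_le i S T : bool :=
  all2 (cyc_le i) (sort (cyc_le i) (enum S)) (sort (cyc_le i) (enum T)).

Definition positroid (k : nat) J : {set {set 'I_n}} :=
  [set B : {set 'I_n} | (#|B| == k) && [forall i, gale_le i (J i) B]].

Definition is_matroid_on A M : Prop :=
  [/\ M != set0, forall B, B \in M -> B \subset A &
      forall B1 B2 x, B1 \in M -> B2 \in M -> x \in B1 :\: B2 ->
        exists2 y, y \in B2 :\: B1 & y |: (B1 :\ x) \in M].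

Definition matroid_connected M : Prop :=
  ~ exists A M1 M2,
      [/\ A != set0, ~: A != set0, is_matroid_on A M1, is_matroid_on (~: A) M2
        & M = [set B1 :|: B2 | B1 in M1, B2 in M2]].

(* A permutation in one-line notation, as the word w_1 ... w_n. *)
Definition word (w : {perm 'I_n}) : seq 'I_n := [seq w i | i <- enum 'I_n].

(* For i = n the condition reads: 1 occurs to the left of n. *)
Definition cDesL (s : seq 'I_n) : {set 'I_n} :=
  [set i | index (ordS i) s < index i s].

(* the cyclic rotation of s ending in r *)
Definition rot_end (r : 'I_n) (s : seq 'I_n) : seq 'I_n := rot (index r s).+1 s.

Definition I_set (r : 'I_n) (w : {perm 'I_n}) : {set 'I_n} :=
  cDesL (rot_end r (word w)).

End Positroids.

Definition des (s : seq nat) : nat :=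
  count (fun i => nth 0 s i.+1 < nth 0 s i) (iota 0 (size s).-1).

Definition D_set (m k : nat) (J : 'I_m.+1 -> {set 'I_m.+1}) :
    {set {perm 'I_m.+1}} :=
  [set w : {perm 'I_m.+1} | [&& w ord_max == ord_max, #|cDesL (word w)| == k &
             [forall r, forall j, gale_le j (J j) (I_set r w)]]].

(* Imported here, not above, because it shadows names of finset such as set0. *)
From mathcomp Require Import classical_sets cardinality reals.

Local Open Scope classical_set_scope.
Local Open Scope ring_scope.

Section Polytopes.
Variable R : realType.

Definition indicator_vec n (B : {set 'I_n}) : 'rV[R]_n :=
  \sum_(b in B) delta_mx 0 b.

(* convex hull of a finite family of points *)
Definition conv_hull n (I : finType) (A : {set I}) (v : I -> 'rV[R]_n) :
    set 'rV[R]_n :=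
  [set x | exists c : I -> R,
     [/\ forall i, i \in A -> 0 <= c i, \sum_(i in A) c i = 1 &
         x = \sum_(i in A) c i *: v i]].

Definition positroid_polytope n (k : nat) (J : 'I_n -> {set 'I_n}) :
    set 'rV[R]_n :=
  conv_hull (positroid k J) (@indicator_vec n).

(* the projection onto the first m of m + 1 coordinates *)
Definition proj_last m : 'rV[R]_m.+1 -> 'rV[R]_m := col' ord_max.

(* S has affine dimension d: its affine hull is x0 + rowspace M, where M has
   d linearly independent rows. *)
Definition affine_dim m (S : set 'rV[R]_m) (d : nat) : Prop :=
  exists (x0 : 'rV[R]_m) (M : 'M[R]_(d, m)),
    [/\ S x0, row_free M, forall i, S (x0 + row i M) &
        forall x, S x -> (x - x0 <= M)%MS].

Definition facet m (Q F : set 'rV[R]_m) : Prop :=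
  (exists (a : 'cV[R]_m) (b : R),
     Q `<=` [set x | (x *m a) 0 0 <= b] /\
     F = Q `&` [set x | (x *m a) 0 0 = b]) /\
  (exists d, affine_dim Q d.+1 /\ affine_dim F d).

(* With coordinates numbered from 0 as in 'I_m; in 1-based numbering this is
   x_{i+1} + ... + x_j, so 1 <= i < j <= n there becomes 0 <= i < j <= m here. *)
Definition interval_sum m (i j : nat) (x : 'rV[R]_m) : R :=
  \sum_(l < m | (i <= l < j)%N) x 0 l.

Definition upper_facet m (Q F : set 'rV[R]_m) : Prop :=
  facet Q F /\
  exists (i j : nat) (c : int),
    [/\ (i < j <= m)%N,
        F = Q `&` [set x | interval_sum i j x = c%:~R] &
        Q `<=` [set x | interval_sum i j x <= c%:~R]].

Definition remove_upper_facets m (Q : set 'rV[R]_m) : set 'rV[R]_m :=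
  Q `\` \bigcup_(F in upper_facet Q) F.

Definition dilate_lattice_points m (Q : set 'rV[R]_m) (t : nat) :
    set 'rV[int]_m :=
  [set z | exists2 x, Q x & t%:R *: x = map_mx intr z].

Local Open Scope card_scope.

Definition ehrhart_poly m (Q : set 'rV[R]_m) (E : {poly rat}) : Prop :=
  forall t : nat, (0 < t)%N ->
    exists2 N : nat, dilate_lattice_points Q t #= `I_N & E.[t%:R] = N%:R.

(* For Q of dimension m in R^m: the identity of formal power series
   h = (1 - z)^(m+1) * \sum_(t >= 0) E(t) z^t, read coefficientwise; E(0) is
   the value of the polynomial E at 0. *)
Definition is_hstar m (Q : set 'rV[R]_m) (h : {poly rat}) : Prop :=
  exists2 E : {poly rat}, ehrhart_poly Q E &
    forall d : nat,
      h`_d = \sum_(t < d.+1) ((1 - 'X) ^+ m.+1)`_(d - t) * E.[t%:R].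

Lemma ehrhart_poly_unique m (Q : set 'rV[R]_m) (E1 E2 : {poly rat}) :
  ehrhart_poly Q E1 -> ehrhart_poly Q E2 -> E1 = E2.
Proof.
move=> H1 H2; apply/eqP; rewrite -subr_eq0; apply/negPn/negP => nz.
pose rs : seq rat := [seq t.+1%:R | t <- iota 0 (size (E1 - E2))].
suff: (size rs < size (E1 - E2)%R)%N by rewrite size_map size_iota ltnn.
apply: max_poly_roots => //.
  apply/allP => _ /mapP[t _ ->]; rewrite /root hornerD hornerN subr_eq0.
  have [N1 c1 ->] := H1 t.+1 isT; have [N2 c2 ->] := H2 t.+1 isT.
  by have := card_eq_trans (card_esym c1) c2; move=> /card_eq_II ->.
by rewrite map_inj_uniq ?iota_uniq // => a b /eqP; rewrite eqr_nat => /eqP[].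
Qed.

Lemma is_hstar_unique m (Q : set 'rV[R]_m) (h1 h2 : {poly rat}) :
  is_hstar Q h1 -> is_hstar Q h2 -> h1 = h2.
Proof.
move=> [E1 H1 h1E] [E2 H2 h2E]; apply/polyP => d.
by rewrite h1E h2E (ehrhart_poly_unique H1 H2).
Qed.

End Polytopes.

(* Main.v *)
(* In the coordinates y_j - y_i = x_i + ... + x_(j-1) the necklace says that the
   positroid polytope is { y_j - y_i <= C i j } for an integral function C that
   satisfies the triangle inequality; connectedness means that C i j + C j i > 0
   for i <> j.  An upper facet passes through every point where some constraint
   with i < j is tight, so the half-open polytope is obtained by making exactly
   these constraints strict.
   A lattice point of its t-th dilate is written y_i = t q_i + r_i, with r_n = t - 1
   the largest residue.  Sorting the letters by (r_i, i) gives a word w with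
   w_n = n; the constraints on y then only involve q and w, they force
   q_(i+1) - q_i to be the indicator of the cyclic left descents of w, and they
   hold iff all the vertices I_r(w) of the simplex of w are bases.  The residues
   that produce a given w are the sequences increasing along w, strictly at the
   descents, hence there are binomial(t + n - 2 - des, n - 1) of them, with
   generating function z^(des + 1) / (1 - z)^n. *)
Require Import Defs.
From mathcomp Require Import all_boot all_order all_algebra all_fingroup.
From mathcomp Require Import zify ring lra.

Set Implicit Arguments.
Unset Strict Implicit.
Unset Printing Implicit Defensive.

Import Order.TTheory GRing.Theory Num.Theory.

Local Open Scope nat_scope.

(** * Cyclic intervals and the Gale order *)

(** Counting the entries below each threshold replaces sorting by inequalities that are additive
    over intervals. For the heads, the threshold [b.+1] forces [a <= b]; for thresholds up to [b]
    the tail of [t] contributes nothing. *)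
Lemma all2_leq_sortedP (s t : seq nat) : sorted leq s -> sorted leq t ->
  reflect (size s = size t /\
           forall v, count (fun x => x < v) t <= count (fun x => x < v) s)
          (all2 leq s t).
Proof.
elim: s t => [|a s IHs] [|b t] /=; try by move=> _ _; constructor; case.
  by move=> _ _; constructor.
move=> ss st; have [ss' st'] := (path_sorted ss, path_sorted st).
have amin : all (leq a) s by apply: order_path_min ss; exact: leq_trans.
have bmin : all (leq b) t by apply: order_path_min st; exact: leq_trans.
apply: (iffP andP) => [[ab /(IHs _ ss' st')[-> ct]]|[[sz] ct]].
  by split=> // v; have := ct v; lia.
have ab : a <= b.
  have := ct b.+1; rewrite ltnSn; case: leqP => // ba.
  have /eqP-> : count (fun x => x < b.+1) s == 0; last by lia.
  rewrite -leqn0 leqNgt -has_count; apply/hasPn => x /(allP amin); lia.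
split=> //; apply/(IHs _ ss' st'); split=> // v; have := ct v.
case: (ltnP b v) => bv; first by lia.
suff -> : count (fun x => x < v) t = 0 by lia.
apply/eqP; rewrite -leqn0 leqNgt -has_count; apply/hasPn => x /(allP bmin); lia.
Qed.

Section Cover.
Variable m : nat.
Local Notation n := m.+1.
Implicit Types (B S T : {set 'I_n}) (a b l : nat) (i j x y : 'I_n).

(* The cyclic order on [n] is unrolled: a natural number [a] stands for its
   residue, so that cyclic intervals become intervals [a, b) of length <= n. *)
Definition res a : 'I_n := inord (a %% n).

Lemma val_res a : res a = a %% n :> nat.
Proof. by rewrite inordK // ltn_pmod. Qed.

Lemma res_ord i : res i = i.
Proof. by apply: val_inj; rewrite /= val_res modn_small. Qed.

Lemma resDn a : res (a + n) = res a.
Proof. by rewrite /res modnDr. Qed.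

Lemma ordS_res a : ordS (res a) = res a.+1.
Proof. by apply: val_inj; rewrite /= !val_res -addn1 modnDml addn1. Qed.

Lemma res_inj a b : a <= b < a + n -> res a = res b -> a = b.
Proof.
move=> /andP[ab ba] /(congr1 val); rewrite /= !val_res => /eqP.
rewrite eq_sym eqn_mod_dvd // => /dvdnP[[|q] E]; lia.
Qed.

Definition cnt B a b : nat := \sum_(a <= l < b) (res l \in B).

Lemma cnt_cat B a b c : a <= b -> b <= c -> cnt B a c = cnt B a b + cnt B b c.
Proof. by move=> ab bc; rewrite /cnt (big_cat_nat ab bc). Qed.

Lemma cnt_nil B a : cnt B a a = 0.
Proof. by rewrite /cnt big_geq. Qed.

Lemma cntS B a b : a <= b -> cnt B a b.+1 = cnt B a b + (res b \in B).
Proof. by move=> ab; rewrite /cnt big_nat_recr. Qed.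

Lemma cnt1 B a : cnt B a a.+1 = (res a \in B).
Proof. by rewrite cntS // cnt_nil. Qed.

Lemma cntDn B a b : cnt B (a + n) (b + n) = cnt B a b.
Proof.
by rewrite /cnt big_addn addnK; apply: eq_bigr => l _; rewrite resDn.
Qed.

Lemma eq_cnt B T a b : (forall l, a <= l < b -> (res l \in B) = (res l \in T)) ->
  cnt B a b = cnt T a b.
Proof. by move=> E; apply: eq_big_nat => l /E ->. Qed.

Lemma cnt_setT B a : cnt B a (a + n) = #|B|.
Proof.
elim: a => [|a IHa].
  rewrite add0n /cnt big_mkord -sum1_card [RHS]big_mkcond /=.
  by apply: eq_bigr => i _; rewrite res_ord; case: (_ \in _).
have aan : a.+1 <= a + n by rewrite addnS ltnS leq_addr.
rewrite -IHa addSn cntS // resDn.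
by rewrite [cnt B a (a + n)](cnt_cat _ (leqnSn a) aan) cnt1 addnC.
Qed.

Lemma cyc_pos_res i u : u < n -> cyc_pos i (res (i + u)) = u.
Proof.
move=> un; rewrite /cyc_pos val_res modnDml.
have -> : i + u + (n - i) = u + n by have := ltn_ord i; lia.
by rewrite modnDr modn_small.
Qed.

Lemma res_cyc_pos i x : res (i + cyc_pos i x) = x.
Proof.
apply: val_inj; rewrite /= val_res /cyc_pos modnDmr.
have -> : i + (x + (n - i)) = x + n by have := ltn_ord i; lia.
by rewrite modnDr modn_small.
Qed.

Lemma count_cyc_pos i B v : v <= n ->
  count (fun u => u < v) [seq cyc_pos i x | x <- enum B] = cnt B i (i + v).
Proof.
set s := map _ _; elim: v => [_|v IHv vn].
  by rewrite addn0 cnt_nil; elim: s.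
rewrite addnS cntS ?leq_addr // -IHv 1?ltnW //.
have -> : (res (i + v) \in B : nat) = count_mem v s.
  rewrite count_uniq_mem; last first.
    by rewrite map_inj_uniq ?enum_uniq // => x y E; rewrite -(res_cyc_pos i x) E res_cyc_pos.
  congr (nat_of_bool _); apply/idP/mapP => [vB|[x]].
    by exists (res (i + v)); rewrite ?mem_enum ?cyc_pos_res.
  by rewrite mem_enum => xB ->; rewrite res_cyc_pos.
elim: s {IHv} => //= u s ->; lia.
Qed.

(** The map [cyc_pos i] carries the i-order to the order of natural numbers, and the initial
    segments of the i-order are the intervals [i, b) with [b <= i + n]. *)
Lemma gale_leP i S T :
  reflect (#|S| = #|T| /\ forall b, i <= b <= i + n -> cnt T i b <= cnt S i b)
          (gale_le i S T).
Proof.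
have tot : total (@cyc_le n i) by move=> x y; apply: leq_total.
pose s B := [seq cyc_pos i x | x <- sort (cyc_le i) (enum B)].
have ss B : sorted leq (s B) by rewrite sorted_map; apply: sort_sorted.
have cs B p : count p (s B) = count p [seq cyc_pos i x | x <- enum B].
  by apply/seq.permP/perm_map; rewrite perm_sort.
have -> : gale_le i S T = all2 leq (s S) (s T).
  rewrite /gale_le /s; elim: (sort _ (enum S)) (sort _ (enum T)) => [|x u IHu] [|y v] //=.
  by rewrite IHu.
apply: (iffP (all2_leq_sortedP (ss S) (ss T))); rewrite !size_map !size_sort -!cardE.
  move=> [-> ct]; split=> // b /andP[ib bi]; rewrite -(subnKC ib).
  by have := ct (b - i); rewrite !cs !count_cyc_pos //; lia.
move=> [-> ct]; split=> // v; rewrite !cs; case: (leqP v n) => vn.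
  by rewrite !count_cyc_pos //; apply: ct; lia.
(* All positions are below [n], so a threshold beyond [n] says no more than [n] itself. *)
have all_lt B : count (fun u => u < v) [seq cyc_pos i x | x <- enum B] =
    count (fun u => u < n) [seq cyc_pos i x | x <- enum B].
  apply: eq_in_count => _ /mapP[x _ ->].
  have : cyc_pos i x < n by rewrite /cyc_pos ltn_pmod.
  lia.
by rewrite !all_lt !count_cyc_pos //; apply: ct; lia.
Qed.

End Cover.

(** * Grassmann necklaces and positroids *)

Section Necklace.
Variables (m k : nat) (J : 'I_m.+1 -> {set 'I_m.+1}).
Local Notation n := m.+1.
Implicit Types (B S T : {set 'I_n}) (a b l : nat) (i j x y : 'I_n).
Hypothesis nkJ : grassmann_necklace k J.
Local Notation M := (positroid k J).

(** For [a <= b <= a + n] this is the matroid rank of the cyclic interval [a, b): [J (res m a)] is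
    the Gale-minimal base for the order starting at [a], so it meets every initial interval in as
    many elements as a base can. *)
Definition nk_rank a b : nat := cnt (J (res m a)) a b.
Local Notation c := nk_rank.

(** A necklace step at i can discard only i, so an element survives until its own turn. *)
Lemma nk_mono a a' b : a <= a' <= b -> b < a + n ->
  res m b \in J (res m a) -> res m b \in J (res m a').
Proof.
move=> /andP[aa' a'b] ban; rewrite -(subnKC aa') in a'b *.
elim: (a' - a) a'b => [|u IHu] aub bJ; first by rewrite addn0.
have {IHu}: res m b \in J (res m (a + u)) by apply: IHu => //; lia.
rewrite addnS -ordS_res; have := (proj2 nkJ) (res m (a + u)); case: ifP => _; last by move=> ->.
case=> j -> bu; rewrite !inE bu andbT; apply/orP; right; apply/eqP => E.
by have := @res_inj m (a + u) b; rewrite E => /(_ _ erefl); lia.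
Qed.

Lemma nk_rank_nil a : c a a = 0. Proof. exact: cnt_nil. Qed.

Lemma nk_rankDn a b : c (a + n) (b + n) = c a b.
Proof. by rewrite /nk_rank resDn cntDn. Qed.

Lemma nk_rank_full a : c a (a + n) = k.
Proof. by rewrite /nk_rank cnt_setT (proj1 nkJ). Qed.

(** By [nk_mono], elements of the necklace set at [a] lying in [b, b') are still present at [a'].
    This is submodularity of the rank for [a, b) and [a', b'). *)
Lemma nk_rank_monge a a' b b' : a <= a' <= b -> b <= b' <= a + n ->
  c a b' + c a' b <= c a b + c a' b'.
Proof.
move=> /andP[aa' a'b] /andP[bb' b'a]; rewrite /nk_rank.
rewrite (cnt_cat _ (leq_trans aa' a'b) bb') (cnt_cat _ a'b bb').
suff : cnt (J (res m a)) b b' <= cnt (J (res m a')) b b' by lia.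
rewrite /cnt !big_nat; apply: leq_sum => l /andP[bl lb'].
case: (boolP (res m l \in J (res m a))) => // lJ.
by rewrite (nk_mono _ _ lJ) //; lia.
Qed.

Lemma nk_rank_triangle a l b : a <= l <= b -> b <= a + n -> c a b <= c a l + c l b.
Proof.
move=> al bn; have /andP[al1 lb1] := al.
by have := @nk_rank_monge a l l b; rewrite nk_rank_nil; lia.
Qed.

(** Submodularity for [l, b + n) and [a + n, l + n), whose union is a full turn, of rank [k]. *)
Lemma nk_rank_triangle_wrap a b l : a <= b <= l -> l <= a + n ->
  c a b + k <= c a l + c l (b + n).
Proof.
move=> ab ln; have := @nk_rank_monge l (a + n) (b + n) (l + n).
by rewrite nk_rank_full !nk_rankDn; lia.
Qed.

Lemma cnt_shift S q a b : cnt S (a + q * n) (b + q * n) = cnt S a b.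
Proof.
elim: q => [|q <-]; first by rewrite mul0n !addn0.
by rewrite mulSn ![n + _]addnC !addnA cntDn.
Qed.

Lemma nk_rank_shift q a b : c (a + q * n) (b + q * n) = c a b.
Proof.
elim: q => [|q <-]; first by rewrite mul0n !addn0.
by rewrite mulSn ![n + _]addnC !addnA nk_rankDn.
Qed.

(** Both sides are periodic under a common shift by [n], so any [n] consecutive starting points
    represent all. *)
Lemma nk_bound_from s B :
  (forall a b, s <= a < s + n -> a <= b <= a + n -> cnt B a b <= c a b) ->
  forall a b, a <= b <= a + n -> cnt B a b <= c a b.
Proof.
(* The offset of [a] from [s], raised by [s * n] so that the subtraction does not truncate; its
   remainder modulo [n] locates the representative of [a] in the window. *)
move=> Bs a b ab; pose u := a + s * n - s.
have sn : s <= s * n by rewrite leq_pmulr.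
have un : u %% n < n by rewrite ltn_pmod.
have uE := divn_eq u n.
have aE : a + s * n = s + u %% n + u %/ n * n by rewrite /u in uE *; lia.
have bE : b + s * n = b + s * n - u %/ n * n + u %/ n * n by lia.
rewrite -(cnt_shift _ s) -(nk_rank_shift s) aE bE cnt_shift nk_rank_shift.
by apply: Bs; lia.
Qed.

Lemma positroidP B :
  reflect (#|B| = k /\ forall a b, a <= b <= a + n -> cnt B a b <= c a b)
          (B \in M).
Proof.
rewrite inE; apply: (iffP andP) => [[/eqP Bk /forallP gJ]|[Bk Bc]]; last first.
  split; first exact/eqP.
  apply/forallP => i; apply/gale_leP; rewrite (proj1 nkJ) Bk; split=> // b ib.
  by have := Bc i b ib; rewrite /nk_rank res_ord.
split=> //; apply: (@nk_bound_from 0) => a b /andP[_ an] ab.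
have /gale_leP[_] := gJ (res m a).
by rewrite val_res modn_small //; apply.
Qed.

Lemma necklace_mem i : J i \in M.
Proof.
apply/positroidP; split; first exact: (proj1 nkJ).
apply: (@nk_bound_from i) => a b ia ab.
have [bi|ib] := leqP b (i + n).
  rewrite /nk_rank /cnt !big_nat; apply: leq_sum => l lab.
  case: (boolP (res m l \in J i)) => // lJ.
  by rewrite -{1}(res_ord i) in lJ; rewrite (nk_mono _ _ lJ) //; lia.
(* An interval passing [i + n] is compared through its complement [b, a + n): elements of
   [J (res m a)] there survive up to [i + n], that is, into [J i]. *)
have cc B : #|B| = k -> cnt B a b + cnt B b (a + n) = k.
  by move=> <-; have /andP[ab1 ab2] := ab; rewrite -(cnt_setT B a) (cnt_cat B ab1 ab2).
suff : cnt (J (res m a)) b (a + n) <= cnt (J i) b (a + n).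
  by have := cc _ (proj1 nkJ i); have := cc _ (proj1 nkJ (res m a)); rewrite /nk_rank; lia.
rewrite /cnt !big_nat; apply: leq_sum => l lab.
case: (boolP (res m l \in J (res m a))) => // lJ.
have -> : i = res m (i + n) by rewrite resDn res_ord.
by rewrite (nk_mono _ _ lJ) //; lia.
Qed.

Lemma cnt_set1 x a b : b <= a + n -> cnt [set x] a b <= 1.
Proof.
move=> ban; rewrite -(cards1 x) -(cnt_setT [set x] a).
case: (leqP a b) => ab; last by rewrite /cnt big_geq // ltnW.
by rewrite (cnt_cat _ ab ban) leq_addr.
Qed.

(** If no exchange works, every element of [B2 :\: B1] lies in an interval avoiding [x] on which
    [B1] is tight. Uncrossing these intervals shows that [B2] has no more elements than [B1] outside
    [x], against equal cardinality. *)
Lemma positroid_exchange B1 B2 x : B1 \in M -> B2 \in M -> x \in B1 :\: B2 ->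
  exists2 y, y \in B2 :\: B1 & y |: (B1 :\ x) \in M.
Proof.
move=> /positroidP[B1k B1c] /positroidP[B2k B2c] /setDP[xB1 xB2].
case: (boolP [exists y, (y \in B2 :\: B1) && (y |: (B1 :\ x) \in M)]).
  by case/existsP=> y /andP[yB yM]; exists y.
rewrite negb_exists => /forallP noex; exfalso.
pose tight a b := cnt B1 a b == c a b.
(* Swapping [x] for [p] can only fail by exceeding the rank of an interval; it contains [p], avoids
   [x], and was already tight for [B1]. *)
have covered p : x < p < x + n -> res m p \in B2 :\: B1 ->
    exists a b, [&& x < a, a <= p, p < b, b <= x + n & tight a b].
  move=> xpx pB.
  case: (boolP [exists a : 'I_(x + n).+1, [exists b : 'I_(x + n).+1,
    [&& x < a, a <= p, p < b, b <= x + n & tight a b]]]).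
    by case/existsP=> a /existsP[b H]; exists a, b.
  rewrite negb_exists => /forallP nt; exfalso.
  have := noex (res m p); rewrite pB /= => /negP; apply.
  move: (pB) => /setDP[pB2 pB1].
  apply/positroidP; split.
    rewrite cardsU1 !inE (negPf pB1) andbF /=; move: (cardsD1 x B1); by rewrite xB1 B1k => ->.
  apply: (@nk_bound_from x.+1) => a b xa ab.
  have cE : cnt (res m p |: (B1 :\ x)) a b + cnt [set x] a b =
            cnt B1 a b + cnt [set res m p] a b.
    rewrite /cnt -!big_split; apply: eq_bigr => l _; rewrite !inE.
    case: (eqVneq (res m l) (res m p)) => [->|_] /=.
      by rewrite (negPf pB1); case: eqVneq => // E; rewrite -E (negPf pB1) in xB1.
    by case: eqVneq => [->|]; rewrite ?xB1 //= addn0.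
  have le1 := @cnt_set1 (res m p) a b (proj2 (andP ab)).
  have B1ab := B1c a b ab.
  (* An interval reaching beyond [x + n] contains [x], whose removal offsets the insertion of
     [p]. *)
  have [bx|xb] := leqP b (x + n); last first.
    suff x0 : 0 < cnt [set x] a b.
      by rewrite -(leq_add2r (cnt [set x] a b)) cE leq_add // (leq_trans le1).
    have ax : a <= x + n by lia.
    by rewrite (cnt_cat _ ax (ltnW xb)) (cnt_cat _ (leqnSn (x + n)) xb) cnt1 resDn res_ord inE eqxx; lia.
  have [/andP[ap pb]|npab] := boolP (a <= p < b).
    have aO : a < (x + n).+1 by lia.
    have bO : b < (x + n).+1 by lia.
    have := nt (Ordinal aO); rewrite negb_exists => /forallP /(_ (Ordinal bO)) /=.
    rewrite ap pb bx /tight => Nt.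
    rewrite -(leq_add2r (cnt [set x] a b)) cE (leq_trans (leq_add (leqnn _) le1)) //.
    by rewrite addn1 (leq_trans _ (leq_addr _ _)) // ltn_neqAle B1ab; move: Nt; lia.
  suff p0 : cnt [set res m p] a b = 0.
    by apply: leq_trans B1ab; rewrite -(leq_add2r (cnt [set x] a b)) cE p0 leq_add2l.
  rewrite /cnt big_nat big1 // => l lab; rewrite inE; case: eqVneq => // E.
  case: (leqP l p) => lp.
    by have := @res_inj m l p; rewrite E => /(_ _ erefl); lia.
  by have := @res_inj m p l; rewrite E => /(_ _ erefl); lia.
(* Peel off maximal tight intervals from the right; by submodularity no tight
   interval ever straddles the current endpoint. *)
have peel b : x < b <= x + n ->
    (forall a b', [&& x < a, a < b, b < b', b' <= x + n & tight a b'] -> False) ->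
    cnt B2 x.+1 b <= cnt B1 x.+1 b.
  elim/ltn_ind: b => b IHb /andP[xb bx] nostr.
  have [->|xb1] := eqVneq b x.+1; first by rewrite !cnt_nil.
  pose P a := [&& x < a, a < b & tight a b].
  have [/existsP[a0 Pa0]|] := boolP [exists a : 'I_b, P a].
    have exP : exists a, P a by exists a0.
    (* With [a] least such that [a, b) is tight, a tight interval straddling [a] would by
       submodularity produce a tight interval ending at [b] and starting before [a]. *)
    case: (ex_minnP exP) => a /and3P[xa ab tab] amin.
    rewrite (cnt_cat _ xa (ltnW ab)) (cnt_cat B1 xa (ltnW ab)).
    apply: leq_add; last by rewrite (eqP tab); apply: B2c; lia.
    apply: IHb => //; first by lia.
    move=> a' b' /and5P[xa' a'a ab' b'x tab'].
    have [bb'|b'b] := ltnP b b'; first by apply: (nostr a' b'); lia.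
    have : P a'.
      rewrite /P xa' (ltn_trans a'a ab) /=; apply/eqP.
      have := @nk_rank_monge a' a b' b; have := B1c a' b.
      move/eqP: tab'; move/eqP: tab.
      rewrite (cnt_cat B1 (ltnW a'a) (ltnW ab)) (cnt_cat B1 (ltnW a'a) (ltnW ab')).
      by have := B1c a b'; lia.
    by move/amin; lia.
  rewrite negb_exists => /forallP noP.
  have noP' a : x < a -> a < b -> tight a b -> False.
    by move=> xa ab tab; have := noP (Ordinal ab); rewrite /P /= xa ab tab.
  have xb' : x < b.-1 by lia.
  rewrite -(ltn_predK xb) !cntS //; apply: leq_add.
    apply: IHb; try lia.
    move=> a b' /and5P[xa ab bb' b'x tab'].
    have [E|nE] := eqVneq b' b; first by rewrite E in tab'; apply: (noP' a) => //; lia.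
    by apply: (nostr a b'); lia.
  case: (boolP (res m b.-1 \in B2)) => // bB2; case: (boolP (res m b.-1 \in B1)) => // bB1.
  have [||a [b' /and5P[xa ab bb' b'x tab']]] := covered b.-1; first by lia.
    by rewrite inE bB1.
  have [E|nE] := eqVneq b' b; first by rewrite E in tab'; case: (noP' a) => //; lia.
  by case: (nostr a b'); lia.
have := peel (x + n); have := cnt_setT B1 x; have := cnt_setT B2 x.
have xx : x.+1 <= x + n by rewrite addnS ltnS leq_addr.
rewrite !(cnt_cat _ (leqnSn x) xx) !cnt1 res_ord xB1 (negPf xB2) B1k B2k.
move=> E1 E2 H; suff : cnt B2 x.+1 (x + n) <= cnt B1 x.+1 (x + n) by lia.
by apply: H; [lia|move=> a b'; lia].
Qed.

(** The ranks of [i, j) and its complement add up to [k], so every base fills both blocks exactly.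
    If [a, b) ends in the second block, submodularity makes its rank at least the sum of the ranks
    of its two parts; if it returns to the first block, [S] and [B] have equal counts on it. *)
Lemma cnt_glue (i j a b : nat) B B' S : i <= j <= i + n -> c i j + c j (i + n) = k ->
  B \in M -> B' \in M ->
  (forall l, i <= l < j -> (res m l \in S) = (res m l \in B)) ->
  (forall l, j <= l < i + n -> (res m l \in S) = (res m l \in B')) ->
  i <= a <= j -> a <= b <= a + n -> cnt S a b <= c a b.
Proof.
move=> ij cij /positroidP[Bk Bc] /positroidP[B'k B'c] SB SB' iaj ab.
have full (X : {set 'I_n}) u v : u <= v <= u + n -> cnt X u v + cnt X v (u + n) = #|X|.
  by case/andP=> uv vu; rewrite -(cnt_setT X u) (cnt_cat X uv vu).
have cutS u v w (X : {set 'I_n}) : u <= v -> v <= w -> cnt X u w = cnt X u v + cnt X v w.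
  exact: cnt_cat.
have eqB u v : i <= u -> v <= j -> cnt S u v = cnt B u v.
  by move=> iu vj; apply: eq_cnt => l luv; apply: SB; lia.
have eqB' u v : j <= u -> v <= i + n -> cnt S u v = cnt B' u v.
  by move=> iu vj; apply: eq_cnt => l luv; apply: SB'; lia.
have [bj|jb] := leqP b j; first by rewrite eqB ?Bc //; lia.
have [bi|ib] := leqP b (i + n).
  rewrite (cutS a j b) 1?(eqB a j) 1?(eqB' j b); try lia.
  have := Bc a j; have := B'c j b.
  have := @nk_rank_monge i a j b; have := @nk_rank_triangle_wrap j b (i + n).
  by rewrite nk_rankDn; lia.
have tB X : X \in M -> cnt X j (i + n) = c j (i + n).
  move=> /positroidP[Xk Xc]; have := full X i j ij; have := Xc i j; have := Xc j (i + n).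
  lia.
have tBB' : cnt B' j (i + n) = cnt B j (i + n).
  by rewrite !tB //; apply/positroidP.
have SS : cnt S (i + n) b = cnt B (i + n) b.
  have -> : b = b - n + n by lia.
  by rewrite !cntDn eqB //; lia.
suff -> : cnt S a b = cnt B a b by apply: Bc.
rewrite (cutS a j b) ?(cutS j (i + n) b) ?(cutS a j b B) ?(cutS j (i + n) b B); try lia.
by rewrite (eqB a j) 1?(eqB' j (i + n)) ?tBB' ?SS //; lia.
Qed.

(** Exchange [x] between [B1] and the base that is [B2] on [A] and [B1] elsewhere: the new element
    can only come from [B2] inside [A]. *)
Lemma matroid_restrict (A : {set 'I_n}) :
  (forall B B', B \in M -> B' \in M -> (B :&: A) :|: (B' :&: ~: A) \in M) ->
  is_matroid_on A [set B :&: A | B in M].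
Proof.
move=> glue; split.
- by apply/set0Pn; exists (J ord0 :&: A); apply/imsetP; exists (J ord0); rewrite ?necklace_mem.
- by move=> _ /imsetP[B _ ->]; apply: subsetIr.
move=> _ _ x /imsetP[B1 B1M ->] /imsetP[B2 B2M ->].
rewrite !inE negb_and => /andP[xB2 /andP[xB1 xA]]; rewrite xA orbF in xB2.
have B3M := glue _ _ B2M B1M.
have [|y] := positroid_exchange B1M B3M (x := x).
  by rewrite !inE xA xB1 (negPf xB2).
move=> /setDP[/setUP[/setIP[yB2 yA]|/setIP[yB1' _]] yB1] yM; last by rewrite yB1' in yB1.
exists y; first by rewrite !inE (negPf yB1) yB2 yA.
apply/imsetP; exists (y |: B1 :\ x) => //.
apply/setP => z; rewrite !inE; case: (eqVneq z y) => [->|_] //=.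
by rewrite andbA.
Qed.

(** In case of equality, bases could be glued freely along [i, j) and its complement, making the
    positroid a direct sum. *)
Lemma connected_rank_gt i j : matroid_connected M -> i < j -> k < c i j + c j (i + n).
Proof.
move=> conn ij; have jn := ltn_ord j; have ijn : i <= j <= i + n by lia.
have kc : k <= c i j + c j (i + n).
  by have := @nk_rank_triangle i j (i + n); rewrite nk_rank_full; lia.
rewrite ltn_neqAle kc andbT; apply/eqP => cij; apply: conn.
pose A := [set l : 'I_n | i <= l < j].
have inA l : i <= l < j -> res m l \in A.
  by move=> il; rewrite inE val_res modn_small //; lia.
have notA l : j <= l < i + n -> res m l \in ~: A.
  move=> jl; rewrite !inE val_res; have [ln|nl] := ltnP l n.
    by rewrite modn_small //; lia.
  by rewrite -(subnK nl) modnDr modn_small; lia.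
have glue B B' : B \in M -> B' \in M -> (B :&: A) :|: (B' :&: ~: A) \in M.
  move=> BM B'M; set S := _ :|: _.
  have SB l : i <= l < j -> (res m l \in S) = (res m l \in B).
    by move=> /inA; rewrite !inE => ->; rewrite andbT andbF orbF.
  have SB' l : j <= l < i + n -> (res m l \in S) = (res m l \in B').
    by move=> /notA; rewrite !inE => lA; rewrite lA (negPf lA) andbT andbF.
  have [[Bk Bc] [B'k B'c]] := (positroidP _ BM, positroidP _ B'M).
  apply/positroidP; split.
    rewrite -(cnt_setT S i) (cnt_cat S (_ : i <= j) (_ : j <= i + n)); try lia.
    rewrite (eq_cnt SB) (eq_cnt SB').
    have := cnt_setT B i; have := cnt_setT B' i.
    rewrite !(cnt_cat _ (_ : i <= j) (_ : j <= i + n)); try lia.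
    have := Bc i j; have := Bc j (i + n); have := B'c i j; have := B'c j (i + n).
    lia.
  apply: (@nk_bound_from i) => a b ia ab.
  have [aj|ja] := leqP a j.
    by apply: (@cnt_glue i j a b B B'); rewrite // ?cij; lia.
  apply: (@cnt_glue j (i + n) a b B' B) => //; try lia.
    by rewrite nk_rankDn; lia.
  move=> l il; have -> : l = l - n + n by lia.
  by rewrite resDn SB //; lia.
exists A, [set B :&: A | B in M], [set B :&: ~: A | B in M]; split.
- by apply/set0Pn; exists (res m i); apply: inA; lia.
- by apply/set0Pn; exists (res m j); apply: notA; lia.
- exact: matroid_restrict.
- apply: matroid_restrict => B B' BM B'M.
  by rewrite setCK setUC; apply: glue.
apply/setP => B; apply/idP/imset2P => [BM|[B1 B2 /imsetP[B1' B1M ->] /imsetP[B2' B2M ->] ->]].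
  exists (B :&: A) (B :&: ~: A); [by apply/imsetP; exists B|by apply/imsetP; exists B|].
  by rewrite -setIUr setUCr setIT.
exact: glue.
Qed.

(** * Difference constraints on potentials *)

Local Open Scope ring_scope.

(* The sharp upper bound of x_i + ... + x_(j-1) on the positroid polytope; for
   j < i the cyclic interval is [i, j + n) and x_1 + ... + x_n = k. *)
Definition gap_bound i j : int := (c i (j + (j < i)%N * n))%:Z - ((j < i)%N * k)%:Z.
Local Notation C := gap_bound.

Lemma gap_bound_diag i : C i i = 0.
Proof. by rewrite /gap_bound ltnn addn0 nk_rank_nil. Qed.

(** If l lies on the cyclic interval from i to j this is subadditivity of the rank; otherwise it is
    [nk_rank_triangle_wrap]. *)
Lemma gap_bound_triangle (i l j : 'I_n) : C i j <= C i l + C l j.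
Proof.
have [[ni nl] nj] := (ltn_ord i, ltn_ord l, ltn_ord j).
rewrite /gap_bound.
case: (ltnP l i) => li; case: (ltnP j i) => ji; case: (ltnP j l) => jl;
  rewrite ?mul1n ?mul0n ?addn0; try (exfalso; lia).
- have := @nk_rank_triangle_wrap i (j + n) (l + n).
  by rewrite nk_rankDn; lia.
- have := @nk_rank_triangle i (l + n) (j + n).
  by rewrite nk_rankDn; lia.
- have := @nk_rank_triangle_wrap i j (l + n).
  by rewrite nk_rankDn; lia.
- by have := @nk_rank_triangle i l (j + n); lia.
- by have := @nk_rank_triangle_wrap i j l; lia.
- by have := @nk_rank_triangle i l j; lia.
Qed.

Lemma gap_bound_pos i j : matroid_connected M -> i != j -> 0 < C i j + C j i.
Proof.
move=> conn; rewrite /gap_bound -val_eqE /= neq_ltn.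
case/orP=> ij; have := connected_rank_gt conn ij.
  have -> : (j < i)%N = false by lia.
  by rewrite ij /= !mul0n !mul1n !addn0; lia.
have -> : (i < j)%N = false by lia.
by rewrite ij /= !mul0n !mul1n !addn0; lia.
Qed.

Lemma cnt_gap B i j : #|B| = k ->
  (cnt B 0 j)%:Z - (cnt B 0 i)%:Z =
  (cnt B i (j + (j < i)%N * n))%:Z - ((j < i)%N * k)%:Z.
Proof.
move=> Bk; have [ni nj] := (ltn_ord i, ltn_ord j).
case: (ltnP j i) => ij.
  rewrite !mul1n.
  have ? := cnt_cat B (leq0n i) (_ : i <= n)%N; have ? := cnt_cat B (_ : i <= n)%N (_ : n <= j + n)%N.
  have := cnt_setT B 0; have := cntDn B 0 j; rewrite add0n Bk; lia.
by rewrite (cnt_cat B (leq0n i) ij) mul0n addn0; lia.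
Qed.

Lemma positroid_gapP B :
  reflect (#|B| = k /\ forall i j, (cnt B 0 j)%:Z - (cnt B 0 i)%:Z <= C i j) (B \in M).
Proof.
apply: (iffP (positroidP B)) => -[Bk Bc]; split=> //.
  move=> i j; rewrite cnt_gap // lerD2r lez_nat; apply: Bc.
  by have := ltn_ord i; have := ltn_ord j; lia.
apply: (@nk_bound_from 0) => a b /andP[_ an] ab; rewrite add0n in an.
have aE : res m a = a :> nat by rewrite val_res modn_small.
have H (j : 'I_n) : (cnt B a (j + (j < a) * n) <= c a (j + (j < a) * n))%N.
  by have := Bc (res m a) j; rewrite cnt_gap // lerD2r lez_nat aE.
have [bn|nb] := ltnP b n.
  have bE : res m b = b :> nat by rewrite val_res modn_small.
  by have := H (res m b); rewrite bE ltnNge (proj1 (andP ab)) /= addn0.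
(* Modulo [n] a full turn has the endpoints of the empty interval, so its bound has to come from
   [#|B| = k]. *)
have [->|ban] := eqVneq b (a + n)%N; first by rewrite cnt_setT nk_rank_full Bk.
have bE : res m (b - n) = (b - n)%N :> nat by rewrite val_res modn_small //; lia.
have := H (res m (b - n)); rewrite bE.
have -> : (b - n < a)%N by lia.
by rewrite mul1n subnK.
Qed.

(** A single element has rank at most 1 and the other n - 1 elements have rank at most [k]; this
    encodes 0 <= x_i <= 1. *)
Lemma gap_bound_succ i j : j = i.+1 :> nat -> C i j <= 1 /\ C j i <= 0.
Proof.
move=> ji; rewrite /gap_bound ji ltnSn.
have -> : (i.+1 < i)%N = false by lia.
rewrite /= mul0n mul1n addn0; split.
  by have := cnt1 (J (res m i)) i; rewrite /nk_rank; case: (_ \in _); lia.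
have := nk_rank_full i.+1; have ii : (i.+1 <= i + n)%N by rewrite addnS ltnS leq_addr.
by rewrite /nk_rank (cnt_cat _ ii (leqnSn (i + n)%N)); lia.
Qed.

Lemma gap_bound_last : (0 < m)%N -> C ord_max ord0 <= 1 - k%:Z /\ C ord0 ord_max <= k%:Z.
Proof.
move=> m0; rewrite /gap_bound ltn0 m0 /= mul0n addn0 !mul1n add0n; split.
  by have := cnt1 (J (res m m)) m; rewrite /nk_rank; case: (_ \in _); lia.
have := nk_rank_full 0; rewrite add0n /nk_rank (cnt_cat _ (leq0n m) (leqnSn m)); lia.
Qed.

(** The bounds on single coordinates force consecutive values of an integral potential to differ by
    0 or 1, so it counts the elements of a set. *)
Lemma gap_realize (Y : 'I_n -> int) : (0 < m)%N -> Y ord0 = 0 ->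
  (forall i j, Y j - Y i <= C i j) ->
  exists2 B, B \in M & forall i, (cnt B 0 i)%:Z = Y i.
Proof.
move=> m0 Y0 YC.
(* The value at [n] is [k], the sum of all coordinates. *)
pose Y' a := if (a < n)%N then Y (res m a) else k%:Z.
have Y'E i : Y' i = Y i by rewrite /Y' ltn_ord res_ord.
have Y'n : Y' n = k by rewrite /Y' ltnn.
have stepY a : (a < n)%N -> Y' a.+1 = Y' a \/ Y' a.+1 = Y' a + 1.
  rewrite ltnS leq_eqVlt => /orP[/eqP->|am].
    rewrite Y'n; have -> : Y' m = Y ord_max by rewrite -Y'E.
    have [] := gap_bound_last m0; have := YC ord_max ord0; have := YC ord0 ord_max.
    by rewrite Y0; lia.
  have aE : res m a = a :> nat by rewrite val_res modn_small // ltnW.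
  have a1E : res m a.+1 = a.+1 :> nat by rewrite val_res modn_small.
  have := YC (res m a) (res m a.+1); have := YC (res m a.+1) (res m a).
  have [] := @gap_bound_succ (res m a) (res m a.+1); first by rewrite a1E aE.
  by rewrite -[in Y' a.+1]a1E -[in Y' a]aE !Y'E; lia.
pose B := [set i : 'I_n | Y' i.+1 == Y' i + 1].
have BY a : (a <= n)%N -> (cnt B 0 a)%:Z = Y' a.
  elim: a => [|a IHa] an; first by rewrite cnt_nil -[0%N]/(val (@ord0 m)) Y'E Y0.
  rewrite cntS // PoszD IHa 1?ltnW // inE val_res modn_small //.
  by have [] := stepY a an => ->; rewrite ?eqxx //; case: eqP => //; lia.
exists B; last by move=> i; rewrite BY ?Y'E // ltnW.
apply/positroid_gapP; split=> [|i j]; last by rewrite !BY ?Y'E // ltnW.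
by have := BY n (leqnn n); have := cnt_setT B 0; rewrite add0n Y'n => -> [->].
Qed.

End Necklace.

(** * Words and their cyclic descents *)

Lemma index_rot (T : eqType) (s : seq T) (x : T) a : uniq s -> x \in s -> a <= size s ->
  index x (rot a s) =
  if a <= index x s then index x s - a else index x s + (size s - a).
Proof.
move=> us xs sa; rewrite /rot index_cat size_drop.
have xt : (x \in take a s) = (index x s < a) by rewrite in_take.
have E := cat_take_drop a s; move: (us) (xs).
rewrite -{1 2}E cat_uniq mem_cat xt.
case: (leqP a (index x s)) => [ai|ia] /and3P[_ /hasPn disj _] /= xd.
  rewrite xd; have -> : index x s = a + index x (drop a s); last by rewrite addKn.
  by rewrite -{1}E index_cat xt ltnNge ai /= size_take_min (minn_idPl sa).
have -> : (x \in drop a s) = false.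
  by apply/negP => /disj; rewrite /= xt ia.
have -> : index x s = index x (take a s) by rewrite -{1}E index_cat xt ia.
by rewrite addnC.
Qed.

Section Words.
Variable m : nat.
Local Notation n := m.+1.
Implicit Types (w : {perm 'I_n}) (i j r : 'I_n).

Definition place w i : nat := (w^-1)%g i.

Lemma place_inj w i j : place w i = place w j -> i = j.
Proof. by move=> /val_inj /perm_inj. Qed.

Lemma size_word w : size (word w) = n.
Proof. by rewrite size_map size_enum_ord. Qed.

Lemma word_uniq w : uniq (word w).
Proof. by rewrite map_inj_uniq ?enum_uniq //; apply: perm_inj. Qed.

Lemma mem_word w i : i \in word w.
Proof. by apply/mapP; exists ((w^-1)%g i); rewrite ?mem_enum ?permKV. Qed.

Lemma nth_word w i0 i : nth i0 (word w) i = w i.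
Proof. by rewrite (nth_map i0) ?size_enum_ord // nth_ord_enum. Qed.

Lemma index_word w i : index i (word w) = place w i.
Proof.
rewrite -{1}(permKV w i) -(nth_word w i ((w^-1)%g i)) index_uniq ?word_uniq //.
by rewrite size_word ltn_ord.
Qed.

Lemma in_cDesL_word w i : (i \in cDesL (word w)) = (place w (ordS i) < place w i).
Proof. by rewrite inE !index_word. Qed.

(* Rotating the word moves the letters up to r behind the others. *)
Lemma in_I_set w r i :
  (i \in I_set r w) + (place w r < place w i) =
  (i \in cDesL (word w)) + (place w r < place w (ordS i)).
Proof.
have rn : place w r < n := ltn_ord _.
have jn (j : 'I_n) : place w j < n := ltn_ord _.
rewrite !inE /rot_end !index_rot ?word_uniq ?mem_word ?index_word ?size_word //.
have [<-|ne] := eqVneq i (ordS i); first by rewrite !ltnn.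
have ne' : place w i <> place w (ordS i) by move/place_inj/eqP; rewrite (negPf ne).
have := jn i; have := jn (ordS i).
case: (ltnP (place w r) (place w i)) => a; case: (ltnP (place w r) (place w (ordS i))) => b /=; lia.
Qed.

Local Open Scope ring_scope.

Lemma cnt_I_set w r a :
  (cnt (I_set r w) 0 a)%:Z = (cnt (cDesL (word w)) 0 a)%:Z
    + (place w r < place w (res m a))%N%:Z - (place w r < place w (res m 0))%N%:Z.
Proof.
elim: a => [|a IHa]; first by rewrite !cnt_nil; lia.
rewrite !cntS // !PoszD IHa; have := in_I_set w r (res m a); rewrite ordS_res.
by case: (res m a \in I_set r w); case: (res m a \in cDesL (word w)); lia.
Qed.

Lemma card_I_set w r : #|I_set r w| = #|cDesL (word w)|.
Proof.
have := cnt_I_set w r (0 + n); rewrite resDn addrK !cnt_setT.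
by case.
Qed.

Variables (k : nat) (J : 'I_n -> {set 'I_n}).
Hypothesis nkJ : grassmann_necklace k J.
Local Notation C := (gap_bound k J).
Local Notation cD w i := ((cnt (cDesL (word w)) 0 i)%:Z).

(** The potential of [I_set r w] is, up to a constant, that of [cDesL (word w)] plus the indicator
    of standing to the right of r. From i to j this indicator increases by at most the truth value
    of [place w i < place w j], attained at r = i if that is 1 and at the last letter otherwise. *)
Lemma D_setP w :
  reflect [/\ w ord_max = ord_max, #|cDesL (word w)| = k &
              forall i j, i != j -> cD w j - cD w i + (place w i < place w j)%N%:Z <= C i j]
          (w \in D_set k J).
Proof.
have posI r : (forall j, gale_le j (J j) (I_set r w)) -> #|cDesL (word w)| = k ->
    I_set r w \in positroid k J.
  by move=> g ck; rewrite inE card_I_set ck eqxx; apply/forallP.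
rewrite inE; apply: (iffP and3P) => -[/eqP wm].
  move=> /eqP ck /forallP gH; split=> // i j ij.
  have H r : cD w j + (place w r < place w j)%N%:Z - (cD w i + (place w r < place w i)%N%:Z) <= C i j.
    have /(positroid_gapP nkJ)[_ /(_ i j)] := posI r (fun j => forallP (gH r) j) ck.
    by rewrite !cnt_I_set !res_ord; lia.
  have [pij|pji] := ltnP (place w i) (place w j).
    by have := H i; rewrite pij ltnn; lia.
  have top (l : 'I_n) : (place w (w ord_max) < place w l)%N = false.
    rewrite {1}/place permK /=; have : (place w l < n)%N := ltn_ord _; lia.
  by have := H (w ord_max); rewrite !top; lia.
move=> ck H; split; [exact: wm|exact/eqP|].
apply/forallP => r; apply/forallP => j0.
suff : I_set r w \in positroid k J by rewrite inE => /andP[_ /forallP].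
apply/(positroid_gapP nkJ); split=> [|i j]; first by rewrite card_I_set.
rewrite !cnt_I_set !res_ord; have [->|ij] := eqVneq i j.
  by rewrite gap_bound_diag; lia.
by have := H i j ij; lia.
Qed.

End Words.

(** * Stable sorting *)

Lemma val_perm_card m (p : {perm 'I_m}) i : p i = #|[set j | p j < p i]| :> nat.
Proof.
have -> : [set j | p j < p i] = p @^-1: [set j : 'I_m | j < p i].
  by apply/setP => j; rewrite !inE.
rewrite card_preimset; last exact: perm_inj.
have im : p i <= m := ltnW (ltn_ord (p i)).
have winj : injective (widen_ord im) by move=> a b /(congr1 val) /= /val_inj.
rewrite -[LHS]card_ord -(card_imset predT winj); apply: eq_card => j.
rewrite inE; apply/imsetP/idP => [[l _ ->]|ji]; first exact: (ltn_ord l).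
by exists (Ordinal ji) => //; apply: val_inj.
Qed.

Section StableSort.
Variables (m t : nat).
Local Notation n := m.+1.
Implicit Types (r : {ffun 'I_n -> 'I_t}) (w : {perm 'I_n}) (i j : 'I_n).

Definition stable_lt r : rel 'I_n := fun i j => (r i < r j) || ((r i == r j) && (i < j)).

Definition sorts w r : Prop := forall i j, (place w i < place w j) = stable_lt r i j.

Definition stable_rank r i : 'I_n := inord #|[set j | stable_lt r j i]|.

Lemma stable_ltP r i j : stable_lt r i j = (r i < r j) || ((r i == r j :> nat) && (i < j)).
Proof. by []. Qed.

Lemma stable_rankE r i : stable_rank r i = #|[set j | stable_lt r j i]| :> nat.
Proof.
rewrite inordK // ltnS -ltnS -[n in _ < n]card_ord -cardsT; apply: proper_card.
by apply/properP; split=> //; exists i => //; rewrite inE stable_ltP; lia.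
Qed.

Lemma stable_rank_lt r i j : stable_lt r i j -> stable_rank r i < stable_rank r j.
Proof.
move=> ij; rewrite !stable_rankE; apply: proper_card; apply/properP; split.
  by apply/subsetP => l; rewrite !inE; move: ij; rewrite !stable_ltP; lia.
by exists i; rewrite !inE // stable_ltP; lia.
Qed.

Lemma stable_lt_total r i j : i != j -> stable_lt r i j || stable_lt r j i.
Proof. by rewrite -val_eqE /= !stable_ltP; lia. Qed.

Lemma stable_rank_inj r : injective (stable_rank r).
Proof.
move=> i j E; apply/eqP; apply: contraT => /(stable_lt_total r)/orP[] /stable_rank_lt.
  by rewrite E ltnn.
by rewrite E ltnn.
Qed.

Definition stable_sort r : {perm 'I_n} := ((perm (@stable_rank_inj r))^-1)%g.

Lemma stable_sortP r : sorts (stable_sort r) r.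
Proof.
move=> i j; rewrite /place invgK !permE.
have [->|ij] := eqVneq i j; first by rewrite ltnn stable_ltP; lia.
have [ij'|] := boolP (stable_lt r i j); first exact: stable_rank_lt.
have := stable_lt_total r ij; case/orP=> [-> //|ji] _.
by rewrite ltnNge ltnW // stable_rank_lt.
Qed.

(** A permutation is recovered from the relative order of its values by counting the smaller ones;
    here this is applied to the inverses. *)
Lemma stable_sort_uniq w r : sorts w r -> w = stable_sort r.
Proof.
move=> wr; apply: invg_inj; apply/permP => i; apply: val_inj => /=.
rewrite val_perm_card [RHS]val_perm_card; apply: eq_card => j; rewrite !inE.
by have := wr j i; rewrite -(stable_sortP r j i).
Qed.

End StableSort.

(** * Counting the residues sorted by a given word *)

Section SortCount.
Variables (m t' : nat) (w : {perm 'I_m.+1}).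
Local Notation n := m.+1.
Local Notation t := t'.+1.
Hypotheses (m_gt0 : 0 < m) (w_max : w ord_max = ord_max).
Implicit Types (r : {ffun 'I_n -> 'I_t}) (i j : 'I_n) (p q : nat).

Definition letter p : 'I_n := w (inord p).
Definition descent p := letter p.+1 < letter p.
Definition descents p : nat := count descent (iota 0 p).

Lemma descentsS p : descents p.+1 = descents p + descent p.
Proof. by rewrite /descents -[p.+1]addn1 iotaD count_cat /= addn0. Qed.

Lemma place_letter p : p < n -> place w (letter p) = p.
Proof. by move=> pn; rewrite /place permK inordK. Qed.

Lemma letter_place i : letter (place w i) = i.
Proof. by rewrite /letter inord_val permKV. Qed.

Lemma letter_last : letter m = ord_max.
Proof.
rewrite /letter -[RHS]w_max; congr (w _); apply: val_inj; exact: inordK.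
Qed.

Lemma leq_descents p q : p <= q -> descents p <= descents q.
Proof.
by move=> pq; rewrite -(subnK pq); elim: (q - p) => // u IH; rewrite addSn descentsS (leq_trans IH) ?leq_addr.
Qed.

Lemma letter_lt p q : p < q -> q < n -> descents q = descents p -> letter p < letter q.
Proof.
elim: q => // q IHq; rewrite ltnS leq_eqVlt => /orP[/eqP <-|pq] qn E.
  have : letter p <> letter p.+1.
    move/(congr1 (place w)); rewrite !place_letter //; lia.
  rewrite descentsS in E; have : descent p = false by case: descent E; lia.
  by rewrite /descent => /negbT; rewrite -leqNgt leq_eqVlt => /orP[/eqP/val_inj -> //|].
have le := leq_descents (ltnW pq); rewrite descentsS in E.
have {}IHq := IHq pq (ltnW qn) _; apply: ltn_trans (IHq _) _; first by lia.
have : letter q <> letter q.+1.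
  move/(congr1 (place w)); rewrite !place_letter //; lia.
have : descent q = false by case: descent E; lia.
by rewrite /descent => /negbT; rewrite -leqNgt leq_eqVlt => /orP[/eqP/val_inj -> //|].
Qed.

Lemma des_word : des (map val (take m (word w))) = descents m.-1.
Proof.
have szm : size (map val (take m (word w))) = m.
  by rewrite size_map size_takel // size_word.
rewrite /des szm; apply: eq_in_count => p; rewrite mem_iota add0n => /andP[_ pm].
have nthE l : l < m -> nth 0 (map val (take m (word w))) l = letter l.
  move=> lm; rewrite (nth_map ord0) ?size_takel ?size_word // nth_take //.
  have ln : l < n by rewrite ltnS ltnW.
  by rewrite -{1}(inordK ln) nth_word.
by rewrite !nthE //; lia.
Qed.

(** The last letter is the largest, so no descent leads to it. *)
Lemma descents_last : descents m = descents m.-1.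
Proof.
rewrite -{1}(prednK m_gt0) descentsS /descent prednK // letter_last /=.
have : letter m.-1 < n by []; lia.
Qed.

Lemma descents_le p : descents p <= p.
Proof. by rewrite (leq_trans (count_size _ _)) // size_iota. Qed.

(** Along the word the residue never drops, and at a descent it must rise, since ties are broken by
    the letters. Hence the residue minus the number of earlier descents is weakly increasing. *)
Lemma sorts_gap r : sorts w r -> forall p q, p <= q -> q < n ->
  r (letter p) + descents q <= r (letter q) + descents p.
Proof.
move=> wr p q pq; rewrite -(subnKC pq); elim: (q - p) => [|u IHu] un.
  by rewrite addn0.
rewrite addnS descentsS in un *; have := IHu (ltnW un).
have := wr (letter (p + u)) (letter (p + u).+1).
rewrite (place_letter un) (place_letter (ltnW un)) ltnSn stable_ltP /descent.
have : letter (p + u) <> letter (p + u).+1 :> nat.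
  by move/val_inj/(congr1 (place w)); rewrite (place_letter un) (place_letter (ltnW un)); lia.
lia.
Qed.

(** Equal residues leave no descent between their positions, so there the letters increase, as the
    tie-break requires. *)
Lemma gap_sorts r : (forall p q, p <= q -> q < n ->
    r (letter p) + descents q <= r (letter q) + descents p) -> sorts w r.
Proof.
move=> H.
have lt i j : place w i < place w j -> stable_lt r i j.
  move=> pij; have := H _ _ (ltnW pij) (ltn_ord _); rewrite !letter_place stable_ltP.
  have le := leq_descents (ltnW pij).
  have := letter_lt pij (ltn_ord _); rewrite !letter_place; lia.
move=> i j; case: (ltngtP (place w i) (place w j)) => pij.
- by rewrite lt.
- by have := lt _ _ pij; rewrite !stable_ltP; lia.
by rewrite (place_inj pij) stable_ltP; lia.
Qed.

(** Subtracting the number of earlier descents from the residues of the first [m] letters gives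
    exactly the weakly increasing sequences of length [m] with values in [0, t' - d]; the last
    residue is fixed to [t']. *)
Lemma card_stable_sort :
  #|[set r : {ffun 'I_n -> 'I_t} | (r ord_max == ord_max) && (stable_sort r == w)]|
  = 'C(t + (m.-1 - des (map val (take m (word w)))), m).
Proof.
rewrite des_word -descents_last; set d := descents m; set R := [set r | _].
have dm : d <= m.-1 by rewrite /d descents_last descents_le.
have RP r : reflect (r ord_max = ord_max /\ sorts w r) (r \in R).
  rewrite inE; apply: (iffP andP) => -[/eqP rm].
    by move/eqP => <-; split=> //; apply: stable_sortP.
  by move/stable_sort_uniq <-; rewrite eqxx.
have top r : r ord_max = ord_max -> sorts w r -> forall p, p <= m ->
    r (letter p) + d <= t' + descents p.
  by move=> rm wr p pm; have := sorts_gap wr pm (ltnSn m); rewrite letter_last rm.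
(* There is no room for [d] jumps below [t'], and the binomial coefficient vanishes as well. *)
have [td|dt] := ltnP t' d.
  rewrite bin_small; last by lia.
  apply: eq_card0 => r; apply/negP => /RP[rm wr]; have := top r rm wr 0 (leq0n _).
  rewrite /descents /=; lia.
have -> : t + (m.-1 - d) = m + (t' - d) by lia.
rewrite -card_sorted_tuples; set T := [set s | _].
pose val_at (s : m.-tuple 'I_(t' - d).+1) p := nth 0 (map val s) p.
have val_at_le s p : val_at s p <= t' - d.
  rewrite /val_at; have [ps|ps] := ltnP p (size (map val s)); last by rewrite nth_default.
  by have /mapP[x _ ->] := mem_nth 0 ps; rewrite -ltnS ltn_ord.
pose f (s : m.-tuple 'I_(t' - d).+1) : {ffun 'I_n -> 'I_t} :=
  [ffun i => inord (if place w i < m then val_at s (place w i) + descents (place w i) else t')].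
have fE s p : p < m -> f s (letter p) = val_at s p + descents p :> nat.
  move=> pm; rewrite ffunE (place_letter (leqW pm)) pm inordK // ltnS.
  by have := val_at_le s p; have := leq_descents (ltnW pm); rewrite -/d; lia.
have fm s : f s ord_max = ord_max.
  by apply: val_inj; rewrite -letter_last ffunE place_letter // ltnn /= inordK.
have -> : R = f @: T.
  apply/setP => r; apply/RP/imsetP => [[rm wr]|[s]]; last first.
    rewrite inE => ss ->; split; first exact: fm.
    apply: gap_sorts => p q pq qn.
    have [->|qm] := eqVneq q m.
      rewrite letter_last fm /=; have [->|pm] := eqVneq p m.
        by rewrite letter_last fm.
      rewrite fE; last by lia.
      by have := val_at_le s p; rewrite -/d; lia.
    rewrite !fE; try lia.
    have : val_at s p <= val_at s q.
      apply: (sorted_leq_nth leq_trans leqnn 0 ss) => //;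
      rewrite inE size_map size_tuple; lia.
    lia.
  have dr p : p <= m -> descents p <= r (letter p).
    by move=> pm; have := sorts_gap wr (leq0n p) pm; rewrite /descents /=; lia.
  pose s := [tuple (inord (r (letter (p : 'I_m)) - descents p) : 'I_(t' - d).+1) | p < m].
  have sE p : p < m -> val_at s p = r (letter p) - descents p.
    move=> pm; rewrite /val_at (nth_map ord0) ?size_tuple //.
    rewrite -[p in nth _ _ p]/(val (Ordinal pm)) -tnth_nth tnth_mktuple /= inordK //.
    by have := top r rm wr p (ltnW pm); have := dr p (ltnW pm); lia.
  exists s.
    rewrite inE; apply/(sortedP 0) => p; rewrite size_map size_tuple => pm.
    have := sE _ pm; have := sE _ (ltnW pm); rewrite /val_at => -> ->.
    have h := sorts_gap wr (leqnSn p) (ltnW pm : p.+1 < n).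
    have d1 := dr p.+1 (ltnW pm).
    rewrite leq_subLR addnBA // leq_subRL ?(leq_trans d1 (leq_addl _ _)) //.
    by rewrite addnC [X in _ <= X]addnC.
  apply/ffunP => i; rewrite -(letter_place i); have pn : place w i < n := ltn_ord _.
  have [pm|pm] := ltnP (place w i) m.
    apply: val_inj; rewrite /= fE // sE // subnK // dr // ltnW.
  have -> : place w i = m by lia.
  by rewrite letter_last fm.
rewrite card_in_imset // => s1 s2 _ _ E; apply/val_inj/(inj_map val_inj).
apply: (@eq_from_nth _ 0) => [|p]; rewrite !size_map !size_tuple // => pm.
by have := fE s1 p pm; rewrite E fE // => /addIn.
Qed.

End SortCount.

Local Open Scope ring_scope.

(** * Series *)

(** This is z^(d+1) / (1-z)^(p+1) = sum of C(j-d-1+p, p) z^j up to degree [D]. One factor [1 - 'X]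
    takes differences of coefficients, and Pascal's rule lowers [p]. *)
Lemma shifted_binomial_series (d p D : nat) (q : {poly rat}) :
  (forall j, (j <= D)%N -> q`_j = (if d < j then 'C(j - d.+1 + p, p) else 0)%N%:R) ->
  forall j, (j <= D)%N -> ((1 - 'X) ^+ p.+1 * q)`_j = (j == d.+1)%:R.
Proof.
elim: p q => [|p IHp] q qE j jD; last first.
  rewrite exprSr -mulrA; apply: IHp => // {jD}j jD.
  rewrite mulrBl mul1r coefB coefXM qE //.
  have [->|j0] := posnP j; first by rewrite /= subr0.
  rewrite /= qE 1?(leq_trans (leq_pred j)) //.
  have [dj|] := ltnP d j; last by move=> jd; rewrite ifN ?subr0 // -leqNgt; lia.
  case: ifP => dj1.
    rewrite -natrB; last by apply: leq_bin2l; lia.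
    have -> : (j - d.+1 + p.+1 = (j.-1 - d.+1 + p.+1).+1)%N by lia.
    rewrite binS addnC addnK; congr 'C(_, _)%:R; lia.
  have -> : j = d.+1 by lia.
  by rewrite subnn !add0n !binn subr0.
rewrite expr1 mulrBl mul1r coefB coefXM qE // bin0.
have [->|j0] := posnP j; first by rewrite /= subr0.
rewrite /= qE 1?(leq_trans (leq_pred j)) // bin0.
case: (ltngtP j d.+1) => jd.
- by rewrite !ifN ?subrr // -leqNgt; lia.
- by rewrite !ifT ?subrr //; lia.
by rewrite jd /= ltnn subr0.
Qed.

Definition binomial_poly (m e : nat) : {poly rat} :=
  (m`!%:R^-1) *: \prod_(i < m) ('X + (e%:R - i%:R)%:P).

Lemma binomial_polyE m e t : (binomial_poly m e).[t%:R] = 'C(t + e, m)%:R.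
Proof.
rewrite /binomial_poly hornerZ horner_prod.
have fn0 : (m`!%:R : rat) != 0 by rewrite pnatr_eq0 -lt0n fact_gt0.
apply: (mulfI fn0); rewrite mulrA divff // mul1r -natrM mulnC bin_ffact ffact_prod natr_prod.
have [tm|mt] := leqP m (t + e).
  apply: eq_bigr => i _; rewrite hornerD hornerX hornerC natrB ?natrD; last by have := ltn_ord i; lia.
  by rewrite addrA.
(* When t + e < m, the factor with index t + e vanishes on both sides. *)
rewrite (bigD1 (Ordinal mt)) //= [RHS](bigD1 (Ordinal mt)) //= subnn mul0r hornerD hornerX hornerC.
by rewrite natrD addrA subrr mul0r.
Qed.

(** * Potentials and lattice points *)

Section Potentials.
Variables (V : zmodType) (m : nat).
Implicit Types (x y : 'rV[V]_m) (a b : nat) (f : 'I_m.+1 -> V).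

Definition pot x a : V := \sum_(l < m | (l < a)%N) x 0 l.

Lemma pot0 x : pot x 0 = 0.
Proof. by rewrite /pot big_pred0. Qed.

Lemma pot_sub x a b : (a <= b)%N -> pot x b - pot x a = \sum_(l < m | (a <= l < b)%N) x 0 l.
Proof.
move=> ab; rewrite /pot (bigID (fun l : 'I_m => l < a)%N) /=.
have -> : \sum_(l < m | (l < b)%N && (l < a)%N) x 0 l = \sum_(l < m | (l < a)%N) x 0 l.
  by apply: eq_bigl => l; lia.
by rewrite addrAC subrr add0r; apply: eq_bigl => l; lia.
Qed.

Lemma pot_succ x (l : 'I_m) : pot x l.+1 - pot x l = x 0 l.
Proof.
rewrite pot_sub // (eq_bigl (pred1 l)) ?big_pred1_eq // => i.
by rewrite /= -val_eqE /=; lia.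
Qed.

Lemma potD x y a : pot (x + y) a = pot x a + pot y a.
Proof. by rewrite /pot -big_split; apply: eq_bigr => l _; rewrite mxE. Qed.

Lemma potB x y a : pot (x - y) a = pot x a - pot y a.
Proof. by rewrite /pot -sumrB; apply: eq_bigr => l _; rewrite !mxE. Qed.

Lemma pot_inj x y : (forall i : 'I_m.+1, pot x i = pot y i) -> x = y.
Proof.
move=> xy; apply/rowP => l; rewrite -!pot_succ.
have := xy (inord l); have := xy (inord l.+1).
by rewrite !inordK ?ltnS ?(ltnW (ltn_ord l)) // => -> ->.
Qed.

Definition of_pot f : 'rV[V]_m := \row_l (f (inord l.+1) - f (inord l)).

Lemma of_potK f (i : 'I_m.+1) : pot (of_pot f) i = f i - f ord0.
Proof.
have H a : (a <= m)%N -> pot (of_pot f) a = f (inord a) - f ord0.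
  elim: a => [_|a IHa am].
    by rewrite pot0 (_ : inord 0 = ord0) ?subrr //; apply: val_inj; rewrite /= inordK.
  have := pot_succ (of_pot f) (Ordinal am); rewrite mxE /= IHa 1?ltnW //.
  by move/eqP; rewrite subr_eq => /eqP ->; rewrite addrA subrK.
by rewrite H ?inord_val // -ltnS.
Qed.

End Potentials.

Lemma potZ (R : pzRingType) m (t : R) (x : 'rV[R]_m) a : pot (t *: x) a = t * pot x a.
Proof. by rewrite /pot mulr_sumr; apply: eq_bigr => l _; rewrite mxE. Qed.

Lemma pot_map (R S : zmodType) (f : {additive R -> S}) m (x : 'rV[R]_m) a :
  pot (map_mx f x) a = f (pot x a).
Proof. by rewrite /pot raddf_sum; apply: eq_bigr => l _; rewrite mxE. Qed.

(** * Lattice points as pairs of quotients and residues *)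

Section Encoding.
Variables (m k t' : nat) (J : 'I_m.+1 -> {set 'I_m.+1}).
Local Notation n := m.+1.
Local Notation t := t'.+1.
Hypotheses (nkJ : grassmann_necklace k J) (m_gt0 : (0 < m)%N).
Local Notation C := (gap_bound k J).
Implicit Types (r : {ffun 'I_n -> 'I_t}) (w : {perm 'I_n}) (i j : 'I_n).
Local Notation cD w i := ((cnt (cDesL (word w)) 0 i)%:Z).

Definition encode r : 'rV[int]_m :=
  of_pot (fun i => t%:Z * cD (stable_sort r) i + (r i)%:Z).

(** The residue difference plus the tie-break term lies in (0, t] if i precedes j in the sorted word
    and in (-t, 0] otherwise; dividing by t and rounding up leaves the indicator. *)
Lemma residue_gap_le r (q : 'I_n -> int) i j c : i != j ->
  (t%:Z * q j + (r j)%:Z - (t%:Z * q i + (r i)%:Z) + (i < j)%N%:Z <= t%:Z * c) =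
  (q j - q i + (place (stable_sort r) i < place (stable_sort r) j)%N%:Z <= c).
Proof.
rewrite stable_sortP stable_ltP -val_eqE /= => ij.
have := ltn_ord (r i); have := ltn_ord (r j).
move: (nat_of_ord (r i)) (nat_of_ord (r j)) => ri rj rjt rit.
have -> : (t%:Z * q j + rj%:Z - (t%:Z * q i + ri%:Z) + (i < j)%N%:Z <= t%:Z * c)
  = (rj%:Z - ri%:Z + (i < j)%N%:Z <= t%:Z * (c - (q j - q i))).
  by apply/idP/idP; lia.
have -> b : (q j - q i + b <= c) = (b <= c - (q j - q i)) by rewrite lerBrDl.
move: (c - (q j - q i)) => d.
case: (boolP ((ri < rj) || ((ri == rj) && (i < j)))%N) => lt /=.
  have : 0 < rj%:Z - ri%:Z + (i < j)%N%:Z <= t%:Z by lia.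
  move: (rj%:Z - ri%:Z + (i < j)%N%:Z) => v /andP[v0 vt]; apply/idP/idP => H; nia.
have : - t%:Z < rj%:Z - ri%:Z + (i < j)%N%:Z <= 0 by lia.
move: (rj%:Z - ri%:Z + (i < j)%N%:Z) => v /andP[v0 vt]; apply/idP/idP => H; nia.
Qed.

(** For integers, strictness of the constraints with i < j is the added 1. *)
Definition in_gap_lattice (z : 'rV[int]_m) : Prop := forall i j, i != j ->
  pot z j - pot z i + (i < j)%N%:Z <= t%:Z * C i j.

Lemma stable_sort_max r : r ord_max = ord_max -> stable_sort r ord_max = ord_max.
Proof.
move=> rm; set w := stable_sort r; apply/eqP; apply: contraT => ne.
have : stable_lt r (w ord_max) ord_max.
  have l1 : (w ord_max < m)%N.
    by rewrite ltn_neqAle -ltnS ltn_ord andbT; exact: ne.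
  have l2 : (r (w ord_max) < t)%N := ltn_ord _.
  by rewrite stable_ltP rm /=; lia.
rewrite -stable_sortP /place permK /= ltnNge -ltnS.
have -> // : ((w^-1)%g ord_max < n)%N := ltn_ord _.
Qed.

Lemma pot_encode r i j : pot (encode r) j - pot (encode r) i =
  t%:Z * cD (stable_sort r) j + (r j)%:Z - (t%:Z * cD (stable_sort r) i + (r i)%:Z).
Proof. by rewrite !of_potK opprB addrA subrK. Qed.

Lemma encode_lattice r : r ord_max = ord_max ->
  stable_sort r \in D_set k J -> in_gap_lattice (encode r).
Proof.
move=> rm /(D_setP nkJ)[_ _ H] i j ij.
by rewrite pot_encode (residue_gap_le r (fun i : 'I_n => cD (stable_sort r) i)) // H.
Qed.

(** For consecutive letters the two opposite constraints leave one value for the increment of [q]: 1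
    if the next letter stands to the left, 0 otherwise. *)
Lemma gap_cDesL w (q : 'I_n -> int) : w ord_max = ord_max ->
  (forall i j, i != j -> q j - q i + (place w i < place w j)%N%:Z <= C i j) ->
  #|cDesL (word w)| = k /\ forall i, cD w i = q i - q ord0.
Proof.
move=> wm H.
have place_max : place w ord_max = m by rewrite /place -{1}wm permK.
have cDq a : (a <= m)%N -> cD w a = q (res m a) - q ord0.
  elim: a => [|a IHa] am.
    by rewrite cnt_nil (_ : res m 0 = ord0) ?subrr //; apply: val_inj; rewrite /= val_res.
  rewrite cntS // PoszD IHa 1?ltnW // in_cDesL_word ordS_res.
  have aE : res m a = a :> nat by rewrite val_res modn_small // ltnS ltnW.
  have a1E : res m a.+1 = a.+1 :> nat by rewrite val_res modn_small.
  have ne : res m a != res m a.+1 by rewrite -val_eqE /= aE a1E; lia.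
  have [c1 c2] := @gap_bound_succ m k J nkJ (res m a) (res m a.+1) (etrans a1E (congr1 S (esym aE))).
  have h1 := H _ _ ne; have := H _ _ (negbT (etrans (eq_sym _ _) (negPf ne))).
  have : place w (res m a) <> place w (res m a.+1) by move/place_inj/eqP; rewrite (negPf ne).
  by move: h1 c1 c2; case: ltngtP => //; lia.
have cDi i : cD w i = q i - q ord0 by rewrite cDq ?res_ord // -ltnS.
(* The bounds for the last coordinate force [q ord_max - q ord0 = k - 1]; the letter n stands last,
   so it is one more cyclic descent. *)
split=> //; rewrite -(cnt_setT _ 0) add0n cntS // in_cDesL_word ordS_res.
have -> : res m m = ord_max by apply: val_inj; rewrite /= val_res modn_small.
have -> : res m m.+1 = ord0 by apply: val_inj; rewrite /= val_res modnn.
have ne : ord0 != ord_max :> 'I_n by rewrite -val_eqE /=; lia.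
have p0 : (place w ord0 < m)%N.
  have : place w ord0 <> place w ord_max by move/place_inj/eqP; rewrite (negPf ne).
  by have : (place w ord0 < n)%N := ltn_ord _; rewrite place_max; lia.
have [c1 c2] := gap_bound_last nkJ m_gt0.
have := H _ _ ne; have := H _ _ (negbT (etrans (eq_sym _ _) (negPf ne))).
rewrite place_max p0 ltnNge (ltnW p0) /=.
have := cDi ord_max; move: c1 c2 => /=; lia.
Qed.

Lemma lattice_encode z : in_gap_lattice z ->
  exists r, [/\ r ord_max = ord_max, stable_sort r \in D_set k J & z = encode r].
Proof.
(* Only differences matter, so the potential is shifted to give the last letter the residue t -
   1. *)
move=> zL; pose Y i := pot z i - pot z m + t'%:Z.
have t0 : t%:Z != 0 by [].
have rP i : (`|(Y i %% t%:Z)%Z| < t)%N.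
  by have := modz_ge0 (Y i) t0; have := ltz_pmod (Y i) (isT : 0 < t%:Z); lia.
pose r : {ffun 'I_n -> 'I_t} := [ffun i => Ordinal (rP i)].
pose q i := (Y i %/ t%:Z)%Z.
have YE i : Y i = t%:Z * q i + (r i)%:Z.
  rewrite ffunE /= gez0_abs ?modz_ge0 // mulrC; exact: divz_eq.
have Ym : Y ord_max = t'%:Z by rewrite /Y subrr add0r.
have rm : r ord_max = ord_max.
  by apply: val_inj; rewrite ffunE /= Ym modz_small //; lia.
have wm := stable_sort_max rm.
have qC i j : i != j -> q j - q i + (place (stable_sort r) i < place (stable_sort r) j)%N%:Z <= C i j.
  move=> ij; rewrite -(residue_gap_le r q) // -!YE; have := zL i j ij; rewrite /Y; lia.
have [ck cq] := gap_cDesL wm qC.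
exists r; split=> //.
  by apply/(D_setP nkJ); split=> // i j ij; rewrite !cq; have := qC i j ij; lia.
apply: pot_inj => i; rewrite of_potK !cq subrr mulr0 add0r mulrBr.
have := YE i; have := YE ord0; rewrite /Y pot0; lia.
Qed.

Lemma encode_inj r1 r2 : r1 ord_max = ord_max -> r2 ord_max = ord_max ->
  encode r1 = encode r2 -> r1 = r2.
Proof.
move=> r1m r2m E; apply/ffunP => i; apply: val_inj => /=.
have := pot_encode r1 ord_max i; rewrite E pot_encode r1m r2m /=.
have := ltn_ord (r1 i); have := ltn_ord (r2 i).
move: (nat_of_ord (r1 i)) (nat_of_ord (r2 i)) => u v ut vt H.
have : (u%:Z %% t%:Z)%Z = (v%:Z %% t%:Z)%Z.
  apply/eqP; rewrite eqz_mod_dvd; apply/dvdzP.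
  exists (cD (stable_sort r2) i - cD (stable_sort r2) m - (cD (stable_sort r1) i - cD (stable_sort r1) m)).
  by move: H; lia.
by rewrite !modz_nat !modn_small // => -[].
Qed.

End Encoding.

(** * The positroid polytope and its upper facets *)

Section ConvexCombination.
Variables (R : archiRealFieldType) (m k : nat) (J : 'I_m.+1 -> {set 'I_m.+1}).
Hypotheses (nkJ : grassmann_necklace k J) (m_gt0 : (0 < m)%N).
Local Notation n := m.+1.
Local Notation M := (positroid k J).
Local Notation C := (gap_bound k J).
Implicit Type (y : 'I_n -> R).

Definition pot_combination y : Prop := exists c : {set 'I_n} -> R,
  [/\ forall B, B \in M -> 0 <= c B, \sum_(B in M) c B = 1 &
      forall i, y i = \sum_(B in M) c B * (cnt B 0 i)%:R].

Lemma pot_combination_int (Y : 'I_n -> int) : Y ord0 = 0 ->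
  (forall i j, Y j - Y i <= C i j) -> pot_combination (fun i => (Y i)%:~R).
Proof.
move=> Y0 YC; have [B BM BY] := gap_realize nkJ m_gt0 Y0 YC.
exists (fun B' => (B' == B)%:R); split=> [B' _||i].
- exact: ler0n.
- by rewrite (bigD1 B) //= eqxx big1 ?addr0 // => B' /andP[_ /negPf ->].
rewrite (bigD1 B) //= eqxx mul1r big1 ?addr0 -?BY //.
by move=> B' /andP[_ /negPf ->]; rewrite mul0r.
Qed.

Lemma pot_combination_convex t y1 y2 : 0 <= t <= 1 ->
  pot_combination y1 -> pot_combination y2 ->
  pot_combination (fun i => (1 - t) * y1 i + t * y2 i).
Proof.
move=> /andP[t0 t1] [c1 [c10 c1s c1y]] [c2 [c20 c2s c2y]].
exists (fun B => (1 - t) * c1 B + t * c2 B); split=> [B BM||i].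
- by rewrite addr_ge0 // mulr_ge0 ?subr_ge0 ?c10 ?c20.
- by rewrite big_split /= -!mulr_sumr c1s c2s; ring.
rewrite c1y c2y !mulr_sumr -big_split; apply: eq_bigr => B _ /=; ring.
Qed.

(** From y_j <= C + y_i < C + floor(y_i) + 1 and integrality of C. *)
Lemma gap_feasible_floor y : (forall i j, y j - y i <= (C i j)%:~R) ->
  forall i j, Num.floor (y j) - Num.floor (y i) <= C i j.
Proof.
move=> yC i j; rewrite lerBlDl -ltzD1.
rewrite floor_lt_int -addrA [C i j + 1]addrC addrA rmorphD.
have := yC i j; have := floorD1_gt (y i); lra.
Qed.

(* With phi the largest fractional part, y = (1 - phi) floor(y) + phi y' where y'
   rescales the fractional parts by 1 / phi: then y' is feasible again and has
   fewer non-integral values. *)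
Lemma gap_feasible_combination y : y ord0 = 0 ->
  (forall i j, y j - y i <= (C i j)%:~R) -> pot_combination y.
Proof.
have [N] := ubnP #|[set i | y i \isn't a Num.int]|.
elim: N y => // N IHN y leN y0 yC.
pose fr i := y i - (Num.floor (y i))%:~R.
have fr_ge0 i : 0 <= fr i by rewrite subr_ge0 floor_le.
have fr_lt1 i : fr i < 1.
  by have := floorD1_gt (y i); rewrite /fr rmorphD /=; lra.
pose s := [arg max_(i > ord0) fr i]%O.
have smax i : fr i <= fr s.
  by rewrite /s; case: arg_maxP => // j _; apply.
have floorC := gap_feasible_floor yC.
have comb_floor : pot_combination (fun i => (Num.floor (y i))%:~R).
  by apply: pot_combination_int => //; rewrite y0 floor0.
have [fs0|fs_neq0] := eqVneq (fr s) 0.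
  case: comb_floor => c [c0 c1 cy]; exists c; split=> // i; rewrite -cy.
  by apply/eqP; rewrite -subr_eq0 eq_le fr_ge0 andbT -fs0 smax.
have fs_gt0 : 0 < fr s by rewrite lt_def fs_neq0 fr_ge0.
pose y' i := (Num.floor (y i))%:~R + fr i / fr s.
have frfs i : 0 <= fr i / fr s <= 1.
  by rewrite divr_ge0 //= ler_pdivrMr // mul1r.
have comb_y' : pot_combination y'.
  apply: IHN.
  (* Integral values are unchanged, and the value at [s] becomes integral. *)
  - rewrite -ltnS (leq_trans _ leN) // ltnS; apply: proper_card; apply/properP; split.
      apply/subsetP => i; rewrite !inE; apply: contraNN => yint.
      have -> : y' i = y i.
        have /eqP yE : (Num.floor (y i))%:~R == y i by rewrite -intrEfloor.
        by rewrite /y' /fr yE subrr mul0r addr0.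
      exact: yint.
    exists s; rewrite inE.
      by rewrite intrEfloor eq_sym -subr_eq0.
    by rewrite negbK /y' divff //; apply: rpredD; rewrite ?rpred1 ?intr_int.
  - by rewrite /y' /fr y0 floor0 subrr mul0r addr0.
  move=> i j; rewrite /y'.
  (* If the floors are tight, the fractional parts decrease from i to j, also after rescaling.
     Otherwise there is slack 1, enough for rescaled parts in [0, 1]. *)
  have := floorC i j; rewrite le_eqVlt => /orP[/eqP E|lt].
    have frij : fr j <= fr i.
      by have := yC i j; rewrite -E rmorphB /fr /=; lra.
    suff : fr j / fr s <= fr i / fr s by move: E => /(congr1 (intr : int -> R)); rewrite rmorphB /=; lra.
    by rewrite ler_pM2r // invr_gt0.
  have : ((Num.floor (y j) - Num.floor (y i) + 1)%:~R : R) <= (C i j)%:~R by rewrite ler_int lezD1.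
  rewrite rmorphD rmorphB /=; have /andP[? ?] := frfs i; have /andP[? ?] := frfs j.
  lra.
have := pot_combination_convex (t := fr s) _ comb_floor comb_y'.
case; first by rewrite fr_ge0 ltW.
move=> c [c0 c1 cy]; exists c; split=> // i; rewrite -cy /y' mulrDr mulrCA divff // mulr1.
rewrite /fr; ring.
Qed.

End ConvexCombination.

From mathcomp Require Import classical_sets cardinality reals.
Local Open Scope classical_set_scope.
Local Open Scope card_scope.

Lemma small_multiple (R : realFieldType) (I : finType) (s u : I -> R) :
  (forall i, 0 < s i) -> exists2 e, 0 < e & forall i, e * u i <= s i.
Proof.
move=> s0; pose S := \sum_i `|u i| / s i + 1.
have S0 : 0 < S.
  by rewrite ltr_wpDl ?ltr01 // sumr_ge0 // => i _; rewrite divr_ge0 // ltW.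
exists S^-1 => [|i]; first by rewrite invr_gt0.
rewrite mulrC ler_pdivrMr // -ler_pdivrMl // mulrC.
apply: le_trans (ler_norm _) _; rewrite normrM (gtr0_norm (_ : 0 < (s i)^-1)) ?invr_gt0 //.
rewrite /S (bigD1 i) //= -addrA lerDl addr_ge0 ?ler01 // sumr_ge0 // => j _.
by rewrite divr_ge0 // ltW.
Qed.

(** * Dimension and upper facets of a polytope given by difference constraints *)

Section GapPolytope.
Variables (R : realType) (m : nat).
Local Notation n := m.+1.
Variable C : 'I_n -> 'I_n -> int.
Hypothesis C_diag : forall i, C i i = 0.
Hypothesis C_triangle : forall i l j, C i j <= C i l + C l j.
Hypothesis C_pos : forall i j, i != j -> 0 < C i j + C j i.
Implicit Types (x : 'rV[R]_m) (i j l : 'I_n).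

Definition gap_polytope : set 'rV[R]_m :=
  [set x | forall i j : 'I_n, pot x j - pot x i <= (C i j)%:~R].
Local Notation Q := gap_polytope.

(** Averaging preserves constraints and makes strict those that are strict for a single member, so
    interior points of the polytope and of its facets come from integral potentials. *)
Definition mean (G : 'I_n -> 'I_n -> int) i : R := (\sum_b (G b i)%:~R) / n%:R.

Lemma mean_sub G i j (v : int) :
  mean G j - mean G i - v%:~R = (\sum_b (G b j - G b i - v))%:~R / n%:R.
Proof.
rewrite !sumrB sumr_const card_ord !rmorphB /= !rmorph_sum /= rmorphMn /= -mulr_natr.
by rewrite !mulrBl mulfK ?pnatr_eq0.
Qed.

Lemma mean_lt G i j : (forall b, G b j - G b i <= C i j) ->
  (exists b, G b j - G b i < C i j) -> mean G j - mean G i < (C i j)%:~R.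
Proof.
move=> le [b lt]; rewrite -subr_lt0 mean_sub pmulr_llt0 ?invr_gt0 ?ltr0Sn // ltrz0.
rewrite (bigD1 b) //=; apply: (@lt_le_trans _ _ 0); last by [].
rewrite ltr_nwDl ?subr_lt0 // sumr_le0 // => b' _.
by rewrite subr_le0.
Qed.

Lemma mean_eq G i j (v : int) : (forall b, G b j - G b i = v) ->
  mean G j - mean G i = v%:~R.
Proof.
move=> E; apply/eqP; rewrite -subr_eq0 mean_sub big1 ?mul0r // => b _.
by rewrite E subrr.
Qed.

(** Finitely many slacks are positive, so one small step serves all of them, and the tight
    constraints do not move. This supplies the independent points that [affine_dim] asks for. *)
Lemma perturb_rows (T : rel 'I_n) d (N : 'M[R]_(d, m)) (x0 : 'rV[R]_m) :
  (forall i j, i != j -> ~~ T i j -> pot x0 j - pot x0 i < (C i j)%:~R) ->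
  (forall i j, T i j -> pot x0 j - pot x0 i = (C i j)%:~R) ->
  (forall r i j, T i j -> pot (row r N) j - pot (row r N) i = 0) ->
  exists2 e : R, 0 < e & forall r, Q (x0 + e *: row r N).
Proof.
move=> lt0 eq0 N0.
pose s (p : 'I_d * ('I_n * 'I_n)) : R :=
  let: (_, (i, j)) := p in
  if (i == j) || T i j then 1 else (C i j)%:~R - (pot x0 j - pot x0 i).
pose u (p : 'I_d * ('I_n * 'I_n)) : R :=
  let: (r, (i, j)) := p in pot (row r N) j - pot (row r N) i.
have s0 p : 0 < s p.
  case: p => r [i j] /=; case: eqP => [|/eqP ij] //=; case: ifP => // /negbT Tij.
  by rewrite subr_gt0 lt0.
have [e e0 eus] := small_multiple u s0; exists e => // r i j.
rewrite !potD !potZ opprD addrACA -mulrBr.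
have [->|ij] := eqVneq i j; first by rewrite !subrr mulr0 addr0 C_diag.
have [Tij|Tij] := boolP (T i j); first by rewrite N0 // eq0 // mulr0 addr0.
have := eus (r, (i, j)); rewrite /s /u (negPf ij) (negPf Tij) /=; lra.
Qed.

Lemma gap_polytope_dim : affine_dim Q m.
Proof.
pose x0 := of_pot (mean C).
have lt0 i j : i != j -> pot x0 j - pot x0 i < (C i j)%:~R.
  move=> ij; rewrite !of_potK opprB addrA subrK; apply: mean_lt => [b|].
    by rewrite lerBlDl.
  (* The distances from [j] are strict on (i, j), since C i j + C j i > 0. *)
  by exists j; rewrite C_diag; have := C_pos ij; lia.
have [||//|e e0 He] := @perturb_rows (fun _ _ => false) m 1%:M x0 => //.
  by move=> i j ij _; apply: lt0.
have e_unit : e *: (1%:M : 'M[R]_m) \in unitmx.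
  by rewrite scalemx1 unitmxE det_scalar unitrX // unitfE gt_eqF.
exists x0, (e *: 1%:M); split.
- move=> i j; have [->|ij] := eqVneq i j; first by rewrite subrr C_diag.
  exact/ltW/lt0.
- by rewrite row_free_unit.
- by move=> r; rewrite linearZ /=; apply: He.
by move=> x _; apply: submx_full; rewrite row_full_unit.
Qed.

Definition interval_col i j : 'cV[R]_m := \col_l ((i <= l < j)%N)%:R.

Lemma mul_interval_col x i j : (i <= j)%N ->
  (x *m interval_col i j) 0 0 = pot x j - pot x i.
Proof.
move=> ij; rewrite pot_sub // mxE [RHS]big_mkcond /=; apply: eq_bigr => l _.
by rewrite mxE; case: ifP => _; rewrite ?mulr1 ?mulr0.
Qed.

Lemma interval_sum_pot x (i j : nat) : (i <= j)%N -> interval_sum i j x = pot x j - pot x i.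
Proof. by move=> ij; rewrite pot_sub. Qed.

(* [min] is the distance from b in the weighted digraph C to which an arc from
   j to i of weight - C i j has been added, which forces tightness of (i, j). *)
Definition tight_potential i j b l : int := Num.min (C b l) (C b j - C i j + C i l).

Lemma tight_facet i j : (i < j)%N ->
  (forall l, l != i -> l != j -> C i j < C i l + C l j) ->
  upper_facet Q (Q `&` [set x | pot x j - pot x i = (C i j)%:~R]).
Proof.
move=> ij irr; have ijle := ltnW ij.
have ineq : i != j by rewrite -val_eqE /= neq_ltn ij.
have m_gt0 : (0 < m)%N by have := ltn_ord j; lia.
pose G := tight_potential i j; pose x0 := of_pot (mean G).
have x0E (a b : 'I_n) : pot x0 b - pot x0 a = mean G b - mean G a.
  by rewrite !of_potK opprB addrA subrK.
have G_le b i' j' : G b j' - G b i' <= C i' j'.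
  rewrite /G /tight_potential; have := C_triangle b i' j'; have := C_triangle i i' j'; lia.
have G_tight b : G b j - G b i = C i j.
  rewrite /G /tight_potential !C_diag; have := C_triangle b i j.
  have := C_triangle b j i; have := C_pos ineq; lia.
pose T := [rel a b | (a == i) && (b == j)].
have x0_lt (a b : 'I_n) : a != b -> ~~ T a b -> pot x0 b - pot x0 a < (C a b)%:~R.
  move=> ab Tab; rewrite x0E; apply: mean_lt => //; exists b.
  have Gb : G b b = 0.
    by rewrite /G /tight_potential C_diag; have := C_triangle i b j; lia.
  rewrite Gb /G /tight_potential; have Cab := C_pos ab.
  (* A path from i to j through another arc (a, b) is strictly longer than C i j, because no
     intermediate vertex lies on a shortest path. *)
  suff : C i j < C i a + C a b + C b j by lia.
  have t1 := C_triangle i a b; have t2 := C_triangle a b j.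
  have [bi|bi] := eqVneq b i; have [bj|bj] := eqVneq b j; subst.
  - by rewrite eqxx in ineq.
  - have [aj|aj] := eqVneq a j; first by subst a; have := C_pos ineq; lia.
    by have := irr a ab aj; lia.
  - have [ai|ai] := eqVneq a i; first by rewrite /T /= ai !eqxx in Tab.
    by have := irr a ai ab; rewrite C_diag; lia.
  by have := irr b bi bj; lia.
have x0_eq (a b : 'I_n) : T a b -> pot x0 b - pot x0 a = (C a b)%:~R.
  by case/andP => /eqP -> /eqP ->; rewrite x0E; apply: mean_eq.
pose a := interval_col i j.
have rk_a : \rank a = 1%N.
  apply/eqP; rewrite eqn_leq rank_leq_col lt0n mxrank_eq0.
  apply/eqP => /matrixP; have im : (i < m)%N by have := ltn_ord j; lia.
  move/(_ (Ordinal im) 0); rewrite !mxE /= leqnn ij => /eqP; rewrite oner_eq0 //.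
(* The kernel of the interval functional gives m - 1 independent directions inside the facet. *)
have rk_ker : \rank (kermx a) = m.-1 by rewrite mxrank_ker rk_a subn1.
have row0 r (a' b : 'I_n) : T a' b ->
    pot (row r (row_base (kermx a))) b - pot (row r (row_base (kermx a))) a' = 0.
  case/andP => /eqP -> /eqP ->; rewrite -mul_interval_col // -/a.
  have : (row r (row_base (kermx a)) <= kermx a)%MS.
    by rewrite (submx_trans (row_sub _ _)) // eq_row_base.
  by move/sub_kermxP => ->; rewrite mxE.
have [e e0 He] := perturb_rows x0_lt x0_eq row0.
have enz : e != 0 by rewrite gt_eqF.
have x0_Q : Q x0.
  move=> a' b; have [->|ab] := eqVneq a' b; first by rewrite subrr C_diag.
  have [Tab|Tab] := boolP (T a' b); first by rewrite x0_eq.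
  exact/ltW/x0_lt.
have Tij : T i j by rewrite /T /= !eqxx.
split; last first.
  exists i, j, (C i j); split; first by rewrite ij -ltnS ltn_ord.
    by congr (_ `&` _); apply/seteqP; split => x /=; rewrite interval_sum_pot.
  by move=> x Qx /=; rewrite interval_sum_pot.
split.
  exists a, (C i j)%:~R; split; first by move=> x Qx /=; rewrite mul_interval_col.
  by congr (_ `&` _); apply/seteqP; split => x /=; rewrite mul_interval_col.
exists m.-1; split; first by rewrite prednK //; apply: gap_polytope_dim.
rewrite -rk_ker; exists x0, (e *: row_base (kermx a)); split.
- by split => //=; apply: x0_eq.
- rewrite /row_free (eqmx_scale _ enz); exact: row_base_free.
- move=> r; rewrite linearZ /=; split; first exact: He.
  by rewrite /= !potD !potZ opprD addrACA -mulrBr row0 // mulr0 addr0 x0_eq.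
move=> x [Qx /= xij]; rewrite (eqmx_scale _ enz) eq_row_base.
apply/sub_kermxP/matrixP => p q; rewrite !ord1 mul_interval_col // !mxE !potB.
have := x0_eq i j Tij; move: xij; lra.
Qed.

(** If C i j splits as C i l + C l j, both parts are tight at [x]; an unsplittable constraint is a
    facet by [tight_facet]. The induction is on the number of vertices lying between by tight
    constraints. *)
Lemma tight_upper_facet x i j : Q x -> (i < j)%N -> pot x j - pot x i = (C i j)%:~R ->
  exists2 F, upper_facet Q F & F x.
Proof.
move=> Qx.
pose tight (a b : 'I_n) := (a != b) && (pot x b - pot x a == (C a b)%:~R).
pose between (a b : 'I_n) := [pred l | tight a l && tight l b].
have [N] := ubnP #|between i j|; elim: N i j => // N IHN i j leN ij xij.
have ineq : i != j by rewrite -val_eqE /= neq_ltn ij.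
have [/existsP[l /and3P[li lj /eqP Cl]]|noex] :=
  boolP [exists l, [&& l != i, l != j & C i j == C i l + C l j]]; last first.
  exists (Q `&` [set x | pot x j - pot x i = (C i j)%:~R]) => //.
  apply: tight_facet => // l li lj; rewrite lt_neqAle C_triangle andbT.
  by move: noex; rewrite negb_exists => /forallP /(_ l); rewrite li lj.
have CR : (C i j)%:~R = (C i l)%:~R + (C l j)%:~R :> R by rewrite Cl rmorphD.
have til : pot x l - pot x i = (C i l)%:~R.
  by have := Qx i l; have := Qx l j; move: xij CR; lra.
have tlj : pot x j - pot x l = (C l j)%:~R.
  by have := Qx i l; have := Qx l j; move: xij CR; lra.
have tri (a b c : 'I_n) : (C a c)%:~R <= (C a b)%:~R + (C b c)%:~R :> R.
  by rewrite -rmorphD ler_int.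
have cyc (a b : 'I_n) : a != b -> 0 < (C a b)%:~R + (C b a)%:~R :> R.
  by move=> ab; rewrite -rmorphD ltr0z C_pos.
have lb : l \in between i j.
  by rewrite inE /tight eq_sym li lj til tlj !eqxx.
(* As i < j, at least one part is again an upper constraint. It has fewer vertices between: [l] is
   lost, and none is gained because tightness composes and a tight cycle would contradict
   [C_pos]. *)
have [il|il'] := ltnP i l.
  apply: (IHN i l) => //; rewrite -ltnS (leq_trans _ leN) // ltnS.
  apply: proper_card; apply/properP; split; last by exists l; rewrite ?inE /tight // eqxx andbF.
  apply/fintype.subsetP => l'; rewrite !inE /tight => /andP[/andP[il' /eqP til']] /andP[ll' /eqP tl'l].
  rewrite il' til' eqxx /=; have [E|l'j] := eqVneq l' j.
    by subst l'; have := cyc _ _ lj; lra.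
  by rewrite /= eq_le Qx /=; have := tri l' l j; lra.
have lj' : (l < j)%N by have : (l != i :> nat) := li; lia.
apply: (IHN l j) => //; rewrite -ltnS (leq_trans _ leN) // ltnS.
apply: proper_card; apply/properP; split; last by exists l; rewrite ?inE /tight // eqxx.
apply/fintype.subsetP => l'; rewrite !inE /tight => /andP[/andP[ll' /eqP tll']] /andP[l'j /eqP tl'j].
rewrite l'j tl'j eqxx andbT; have [E|il''] := eqVneq i l'.
  by subst l'; have := cyc _ _ li; lra.
by rewrite /= eq_le Qx /=; have := tri i l l'; lra.
Qed.

Lemma remove_upper_facets_gap : remove_upper_facets Q =
  Q `&` [set x | forall i j, (i < j)%N -> pot x j - pot x i < (C i j)%:~R].
Proof.
apply/seteqP; split => x [Qx H]; split => //.
  move=> i j ij; rewrite lt_neqAle Qx andbT; apply/eqP => xij.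
  by have [F FQ Fx] := tight_upper_facet Qx ij xij; apply: H; exists F.
case=> F [_ [i [j [v [/andP[ij jm] FE QF]]]]] Fx.
have im : (i < n)%N by rewrite ltnS (leq_trans (ltnW ij)).
have jn : (j < n)%N by [].
pose oi := Ordinal im; pose oj := Ordinal jn.
have : interval_sum i j x = v%:~R by move: Fx; rewrite FE => -[].
rewrite interval_sum_pot 1?ltnW // => xv; have := H oi oj ij; rewrite xv /=.
(* The distances from i form a feasible point attaining C i j, so the constant of an upper facet is
   at least C i j. *)
pose y : 'rV[R]_m := of_pot (fun l => (C oi l)%:~R).
have yE a b : pot y (b : 'I_n) - pot y (a : 'I_n) = (C oi b - C oi a)%:~R.
  by rewrite !of_potK opprB addrA subrK rmorphB.
have Qy : Q y by move=> a b; rewrite yE ler_int lerBlDl.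
by have /= := QF _ Qy; rewrite interval_sum_pot 1?ltnW // (yE oi oj) C_diag subr0; lra.
Qed.

End GapPolytope.

Section PositroidPolytope.
Variables (R : realType) (m k : nat) (J : 'I_m.+1 -> {set 'I_m.+1}).
Hypotheses (nkJ : grassmann_necklace k J) (m_gt0 : (0 < m)%N).
Local Notation n := m.+1.
Local Notation M := (positroid k J).

Lemma indicator_vecE (B : {set 'I_n}) i : indicator_vec R B 0 i = (i \in B)%:R.
Proof.
rewrite /indicator_vec summxE (eq_bigr (fun b => (b == i)%:R)) => [|b _]; last first.
  by rewrite mxE eqxx eq_sym.
case: (boolP (i \in B)) => iB.
  by rewrite (bigD1 i) //= eqxx big1 ?addr0 // => b /andP[_ /negPf ->].
by rewrite big1 // => b bB; case: eqP => // E; rewrite -E bB in iB.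
Qed.

Lemma pot_indicator (B : {set 'I_n}) (i : 'I_n) :
  pot (proj_last (indicator_vec R B)) i = (cnt B 0 i)%:R.
Proof.
have H a : (a <= m)%N -> pot (proj_last (indicator_vec R B)) a = (cnt B 0 a)%:R.
  elim: a => [|a IHa] am; first by rewrite pot0 cnt_nil.
  rewrite -[LHS](subrK (pot (proj_last (indicator_vec R B)) a)) (pot_succ _ (Ordinal am)).
  rewrite IHa 1?ltnW // cntS // natrD addrC mxE indicator_vecE; congr (_ + (_ \in B)%:R).
  by apply: val_inj; rewrite /= val_res modn_small ?ltnS ?(ltnW am) // /bump leqNgt am.
by rewrite H // -ltnS.
Qed.

Lemma proj_positroid_polytope :
  @proj_last R m @` positroid_polytope k J = @gap_polytope R m (gap_bound k J).
Proof.
have projE (c : {set 'I_n} -> R) (i : 'I_n) :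
    pot (proj_last (\sum_(B in M) c B *: indicator_vec R B)) i =
    \sum_(B in M) c B * (cnt B 0 i)%:R.
  rewrite [RHS](eq_bigr (fun B => pot (c B *: proj_last (indicator_vec R B)) i)); last first.
    by move=> B _; rewrite potZ pot_indicator.
  rewrite /pot exchange_big /=; apply: eq_bigr => l _.
  by rewrite mxE summxE; apply: eq_bigr => B _; rewrite !mxE.
apply/seteqP; split => [_ [x [c [c0 c1 ->]] <-] i j|x Qx].
  have -> : (gap_bound k J i j)%:~R = \sum_(B in M) c B * (gap_bound k J i j)%:~R.
    by rewrite -mulr_suml c1 mul1r.
  rewrite !projE -sumrB; apply: ler_sum => B BM.
  have /(positroid_gapP nkJ)[_ /(_ i j)] := BM.
  rewrite -(ler_int R) rmorphB /= => le; rewrite -mulrBr; apply: ler_wpM2l; last exact: le.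
  exact: c0.
have : pot_combination k J (fun i : 'I_n => pot x i).
  by apply: (gap_feasible_combination nkJ m_gt0); [exact: pot0|exact: Qx].
case=> c [c0 c1 cx].
exists (\sum_(B in M) c B *: indicator_vec R B); first by exists c.
by apply: pot_inj => i; rewrite projE -cx.
Qed.

End PositroidPolytope.

(** * Lattice point count and the h*-polynomial *)

Lemma dilate_gap_polytope (R : realType) (m k t' : nat)
    (J : 'I_m.+1 -> {set 'I_m.+1}) :
  dilate_lattice_points
    (@gap_polytope R m (gap_bound k J) `&`
     [set x | forall i j : 'I_m.+1, (i < j)%N -> pot x j - pot x i < (gap_bound k J i j)%:~R])
    t'.+1
  = in_gap_lattice k t' J.
Proof.
have t0 : 0 < t'.+1%:R :> R by rewrite ltr0Sn.
have potz z (x : 'rV[R]_m) (i j : 'I_m.+1) : t'.+1%:R *: x = map_mx intr z ->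
    (pot z j - pot z i)%:~R = t'.+1%:R * (pot x j - pot x i).
  by move=> xz; rewrite rmorphB /= -!(pot_map intr) -xz !potZ mulrBr.
have castC (i j : 'I_m.+1) :
    (t'.+1%:Z * gap_bound k J i j)%:~R = t'.+1%:R * (gap_bound k J i j)%:~R :> R.
  by rewrite intrM.
apply/seteqP; split => z.
  case=> x [xQ xlt] xz i j ij; have [lt|le] := ltnP i j; last first.
    by rewrite addr0 -(ler_int R) (potz z x) // castC ler_pM2l.
  by rewrite lezD1 -(ltr_int R) (potz z x) // castC ltr_pM2l // xlt.
move=> zL; pose x : 'rV[R]_m := t'.+1%:R^-1 *: map_mx intr z.
have xz : t'.+1%:R *: x = map_mx intr z by rewrite scalerA divff ?scale1r ?gt_eqF.
exists x => //; split=> [i j|i j ij].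
  have [->|ij] := eqVneq i j; first by rewrite subrr gap_bound_diag.
  rewrite -(ler_pM2l t0) -(potz z x) // -castC ler_int.
  by apply: le_trans (zL i j ij); rewrite lerDl.
have ne : i != j by rewrite -val_eqE /= neq_ltn ij.
have := zL i j ne; rewrite ij lezD1.
by rewrite -(ltr_int R) (potz z x) // castC ltr_pM2l.
Qed.

(** Encoding is a bijection from the residue functions whose sorting word is in [D_set]; these are
    counted fibrewise over that word. *)
Lemma card_gap_lattice (m k t' : nat) (J : 'I_m.+1 -> {set 'I_m.+1}) :
  grassmann_necklace k J -> (0 < m)%N ->
  in_gap_lattice k t' J #=
  `I_(\sum_(w in D_set k J) 'C(t'.+1 + (m.-1 - des (map val (take m (word w)))), m)).
Proof.
move=> nkJ m_gt0.
pose rT := {ffun 'I_m.+1 -> 'I_t'.+1}.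
pose S := [set r : rT | (r ord_max == ord_max) && (stable_sort r \in D_set k J)]%SET.
have -> : (\sum_(w in D_set k J) 'C(t'.+1 + (m.-1 - des (map val (take m (word w)))), m) = #|S|)%N.
  rewrite -[RHS]sum1_card (partition_big (@stable_sort m t'.+1) (mem (D_set k J))) /=; last first.
    by move=> r; rewrite inE => /andP[].
  apply: eq_bigr => w wD; have /(D_setP nkJ)[wm _ _] := wD.
  rewrite -(card_stable_sort _ m_gt0 wm) -sum1_card; apply: eq_bigl => r.
  by rewrite 2!finset.in_set -andbA; case: eqVneq => //= _; case: eqP => [->|]; rewrite ?wD ?andbF.
have SP (r : rT) : reflect (r ord_max = ord_max /\ stable_sort r \in D_set k J) (r \in S).
  by rewrite [r \in S]finset.in_set; apply: (iffP andP) => -[/eqP].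
pose f (a : 'I_#|S|) := encode (enum_val a).
have -> : in_gap_lattice k t' J = f @` [set: 'I_#|S|].
  apply/seteqP; split => z.
    move=> /(lattice_encode nkJ m_gt0)[r [rm rD ->]].
    have rS : r \in S by apply/SP.
    by exists (enum_rank_in rS r) => //; rewrite /f enum_rankK_in.
  by case=> a _ <-; have /SP[rm rD] := enum_valP a; apply: encode_lattice.
apply: card_eq_trans (inj_card_eq _) (card_esym card_II) => a b _ _ E.
have /SP[am _] := enum_valP a; have /SP[bm _] := enum_valP b.
by apply: enum_val_inj; apply: encode_inj am bm E.
Qed.

Theorem theorem5p9 (R : realType) (m k : nat)
    (J : 'I_m.+1 -> {set 'I_m.+1}) :
  (1 < m.+1)%N ->
  (1 <= k <= m.+1)%N ->
  grassmann_necklace k J ->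
  matroid_connected (positroid k J) ->
  is_hstar
    (remove_upper_facets (@proj_last R m @` positroid_polytope k J))
    (\sum_(w in D_set k J) 'X^((des (map val (take m (word w)))).+1)).
Proof.
move=> m_gt0 _ nkJ conn.
pose d w := des (map val (take m (word (w : {perm 'I_m.+1})))).
have dm w : w \in D_set k J -> (d w <= m.-1)%N.
  by case/(D_setP nkJ) => wm _ _; rewrite /d des_word //; apply: descents_le.
rewrite proj_positroid_polytope // remove_upper_facets_gap; first last.
- by move=> i j; apply: gap_bound_pos.
- exact: gap_bound_triangle.
- exact: gap_bound_diag.
exists (\sum_(w in D_set k J) binomial_poly m (m.-1 - d w)) => [[//|t'] _|D].
  exists (\sum_(w in D_set k J) 'C(t'.+1 + (m.-1 - d w), m))%N.
    by rewrite dilate_gap_polytope; apply: card_gap_lattice.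
  by rewrite horner_sum natr_sum; apply: eq_bigr => w _; rewrite binomial_polyE.
under [RHS]eq_bigr do rewrite horner_sum mulr_sumr.
rewrite exchange_big coef_sum; apply: eq_bigr => w wD /=.
(* Truncating the series after degree [D] does not affect the coefficient of degree [D]. *)
pose q : {poly rat} := \poly_(t < D.+1) 'C(t + (m.-1 - d w), m)%:R.
transitivity ((1 - 'X) ^+ m.+1 * q)`_D; last first.
  rewrite coefMr; apply: eq_bigr => t _.
  by rewrite binomial_polyE coef_poly ltn_ord.
rewrite coefXn (@shifted_binomial_series (d w) m D) // => j jD.
rewrite coef_poly ltnS jD; congr (_%:R); have := dm w wD.
(* For j <= d the upper index j + (m - 1 - d) is below m, so the series starts at degree d + 1. *)
case: ltnP => dj dwm; last by rewrite bin_small //; lia.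
congr 'C(_, _); lia.
Qed.
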